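(* For every fixed constant number of machines $m$, the problem $Rm|p_{i,j}\in\{p_j,\infty\}|C_{\max}$ can be solved in $\widetilde{O}(p_{\max}^{2^{m+1}+2m-2}+n)$ time, where $n$ is the number of jobs and $p_{\max}=\max_j p_j$.
   Context: Problem $Rm|p_{i,j}\in\{p_j,\infty\}|C_{\max}$: given $n$ jobs with processing times $p_j\in\mathbb{N}$ and $m$ machines, for each machine $i$ and job $j$ the processing time is $p_{i,j}\in\{p_j,\infty\}$, where $p_{i,j}=\infty$ means job $j$ cannot be processed on machine $i$. A schedule is $\sigma:[n]\to[m]$ with $p_{\sigma(j),j}\ne\infty$ for all $j$; its makespan is $\max_{i\in[m]}\sum_{j\in\sigma^{-1}(i)}p_{i,j}$, to be minimized. The number $m$ is a fixed constant. $\widetilde{O}(\cdot)$ suppresses polylogarithmic factors. *)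

(* Defs.v *)
From mathcomp Require Import all_boot.

Set Implicit Arguments.
Unset Strict Implicit.
Unset Printing Implicit Defensive.

(** * The problem Rm | p_ij in {p_j, oo} | C_max *)

(* [ptime i j] is p_ij, with [None] standing for the value oo. *)
Record instance (m n : nat) := Instance {
  p : 'I_n -> nat;
  ptime : 'I_m -> 'I_n -> option nat;
  ptimeP : forall i j, ptime i j = Some (p j) \/ ptime i j = None }.

Definition pmax (m n : nat) (I : instance m n) : nat := \max_(j < n) p I j.

Definition is_schedule (m n : nat) (I : instance m n)
    (sigma : 'I_n -> 'I_m) : Prop :=
  forall j, ptime I (sigma j) j <> None.

(* The default value 0 is never used when [sigma] is a schedule. *)
Definition makespan (m n : nat) (I : instance m n)
    (sigma : 'I_n -> 'I_m) : nat :=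
  \max_(i < m) \sum_(j < n | sigma j == i) odflt 0 (ptime I i j).

Definition optimal (m n : nat) (I : instance m n)
    (sigma : 'I_n -> 'I_m) : Prop :=
  is_schedule I sigma /\
  forall tau, is_schedule I tau -> makespan I sigma <= makespan I tau.

(** * Random access machine with logarithmic cost *)

(* Programs are structured (while-programs rather than goto-programs), which
   changes running times by a constant factor only.  The machine has finitely
   many named registers, as a program mentions finitely many of them, and an
   indirectly addressed memory; both hold natural numbers. *)

Inductive binop := Add | Sub | Mul | Div | Mod | Leq | Eq.

Inductive expr :=
| Const of nat
| Reg of nat
| Read of expr
| Binop of binop & expr & expr.

Inductive cmd :=
| Skip
| Assign of nat & expr
| Store of expr & expr
| Seq of cmd & cmd
| If of expr & cmd & cmd
| While of expr & cmd.

Record state := State { reg : nat -> nat; mem : nat -> nat }.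

Definition update (f : nat -> nat) (a v : nat) : nat -> nat :=
  fun b => if b == a then v else f b.

(* Subtraction is truncated, x / 0 = 0 and x mod 0 = x. *)
Definition eval_binop (o : binop) (x y : nat) : nat :=
  match o with
  | Add => x + y
  | Sub => x - y
  | Mul => x * y
  | Div => x %/ y
  | Mod => x %% y
  | Leq => x <= y
  | Eq => x == y
  end.

Fixpoint eval (s : state) (e : expr) : nat :=
  match e with
  | Const c => c
  | Reg x => reg s x
  | Read a => mem s (eval s a)
  | Binop o e1 e2 => eval_binop o (eval s e1) (eval s e2)
  end.

(* The number of binary digits of [x], with [bits 0 = 1]. *)
Definition bits (x : nat) : nat := (trunc_log 2 x).+1.

(* Every number and address that is handled is charged its binary length:
   [bits (eval s e) <= cost s e] for every [e], so the operands of an operation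
   and the address of a memory access are paid for by the recursive calls. *)
Fixpoint cost (s : state) (e : expr) : nat :=
  match e with
  | Const c => bits c
  | Reg x => bits x + bits (reg s x)
  | Read a => cost s a + bits (eval s e)
  | Binop _ e1 e2 => cost s e1 + cost s e2 + bits (eval s e)
  end.

(* [exec c s t s']: started in state [s], the program [c] halts in state [s']
   after time [t].  Nonzero values count as true. *)
Inductive exec : cmd -> state -> nat -> state -> Prop :=
| ExecSkip s : exec Skip s 1 s
| ExecAssign x e s :
    exec (Assign x e) s (bits x + cost s e)
         (State (update (reg s) x (eval s e)) (mem s))
| ExecStore a e s :
    exec (Store a e) s (cost s a + cost s e)
         (State (reg s) (update (mem s) (eval s a) (eval s e)))
| ExecSeq c1 c2 s1 s2 s3 t1 t2 :
    exec c1 s1 t1 s2 -> exec c2 s2 t2 s3 -> exec (Seq c1 c2) s1 (t1 + t2) s3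
| ExecIfTrue e c1 c2 s s' t :
    eval s e != 0 -> exec c1 s t s' -> exec (If e c1 c2) s (cost s e + t) s'
| ExecIfFalse e c1 c2 s s' t :
    eval s e = 0 -> exec c2 s t s' -> exec (If e c1 c2) s (cost s e + t) s'
| ExecWhileTrue e c s1 s2 s3 t1 t2 :
    eval s1 e != 0 -> exec c s1 t1 s2 -> exec (While e c) s2 t2 s3 ->
    exec (While e c) s1 (cost s1 e + t1 + t2) s3
| ExecWhileFalse e c s :
    eval s e = 0 -> exec (While e c) s (cost s e) s.

(** * Input and output conventions *)

(* The memory initially holds n, followed for each job j by p_j and m flags,
   the i-th of which is 1 if p_ij = p_j and 0 if p_ij = oo. *)
Definition input_words (m n : nat) (I : instance m n) : seq nat :=
  n :: flatten [seq p I j :: [seq nat_of_bool (isSome (ptime I i j))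
                             | i <- enum 'I_m]
               | j <- enum 'I_n].

Definition input (m n : nat) (I : instance m n) : state :=
  State (fun=> 0) (fun a => nth 0 (input_words I) a).

(* Cell 0 finally tells whether the instance has a schedule; if so, an optimal
   one is stored in cells 1, ..., n (machines are numbered from 0). *)
Definition output_correct (m n : nat) (I : instance m n) (s : state) : Prop :=
  (mem s 0 = 1 /\
   exists2 sigma, optimal I sigma & forall j : 'I_n, mem s j.+1 = sigma j) \/
  (mem s 0 = 0 /\ forall sigma, ~ is_schedule I sigma).

(* O~(f) is the union over [C] and [k] of the bounds C * f * (log f)^k; the
   logarithm is replaced by the binary length to keep the factor positive. *)
Definition soft_bound (C k f : nat) : nat := C * f * bits f ^ k.

(* Main.v *)
(* Jobs with the same processing time and the same set of machines are
   interchangeable.  The jobs of one type can be cut in advance into at most [m]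
   bundles of [2 ^ k] jobs for each [k], in such a way that every distribution of
   these jobs over the machines is a distribution of the bundles.  Let the bundles
   be placed from the largest to the smallest.  When those of [2 ^ k] jobs are
   reached, the remaining capacities matter only in units of [2 ^ k], and only up to
   O(pmax ^ 2) units, since what is left to be placed does not need more.  So a
   dynamic program with O(pmax ^ (2 m)) states and O(pmax log n) layers decides
   whether a makespan is possible; the optimal one is found by binary search, and
   the choices of the dynamic program yield the schedule.  This takes time
   O~(pmax ^ (2 m + 1) + n), and 2 m + 1 <= 2 ^ (m + 1) + 2 m - 2 for [m > 0].

   For the logarithmic cost, it suffices that all registers and cells are below
   [2 ^ b] whenever a loop-free part of the program is entered: executing it then
   takes time O(b), with a constant that depends on the program only. *)

From mathcomp Require Import all_boot zify.
Require Import Defs.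

Set Implicit Arguments.
Unset Strict Implicit.
Unset Printing Implicit Defensive.

(** If [x] jobs of one type are spread over [m] machines and every machine pairs up its own jobs, at
    most one job per machine stays single, so at least [(x - m) / 2] pairs exist in every
    distribution. Exactly this number of pairs, rounded up, can thus be formed without knowing the
    distribution, and at most [m] jobs are left over; repeating this on the pairs yields the bundles
    of all levels. A load that consists of bundles of at least [2 ^ k] jobs is a multiple of
    [2 ^ k], so the capacity that it leaves is congruent to [C] modulo [2 ^ k]: rounding down to
    units of [2 ^ k] forgets only a residue that is known. With [Q = pmax + 1] there are [2 ^ m * Q]
    types, hence at most [2 ^ m * Q * m] bundles of [2 ^ j] jobs for each [j], with processing times
    below [Q]. Summed over all [j <= k], their load is less than [2 * (2 ^ m * Q * m) * Q] units of
    [2 ^ k], which is where capacities are truncated. *)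

(** * Binary length *)

Lemma ltn_exp_bits x : x < 2 ^ bits x.
Proof. exact: trunc_log_ltn. Qed.

Lemma bits_leP x b : 0 < b -> (bits x <= b) = (x < 2 ^ b).
Proof.
case: b => // b _; case: (posnP x) => [-> | x_gt0].
  by rewrite expn_gt0 /bits trunc_log0.
apply/idP/idP => [le_xb | lt_xb].
  by apply: leq_trans (ltn_exp_bits x) _; rewrite leq_exp2l.
rewrite ltnS -ltnS -(@ltn_exp2l 2) //.
by apply: leq_ltn_trans lt_xb; exact: trunc_logP.
Qed.

Lemma ltn_bits x i : 0 < x -> (i < bits x) = (2 ^ i <= x).
Proof.
move=> x_gt0; case: i => [|i]; first by rewrite x_gt0.
by rewrite ltnNge bits_leP // -leqNgt.
Qed.

Lemma leq_bits x y : x <= y -> bits x <= bits y.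
Proof. by move=> lexy; rewrite bits_leP //; apply: leq_ltn_trans lexy (ltn_exp_bits y). Qed.

(** * Expressions and loop-free programs *)

(** With all registers and cells below [2 ^ b], both the length of the value of [e] and the cost of
    evaluating [e] are at most [kexpr e * b]. A product can be as long as its factors together, so a
    binary operation pays this sum once for the operands and once for the result. *)
Fixpoint kexpr (e : expr) : nat :=
  match e with
  | Const c => bits c
  | Reg x => (bits x).+1
  | Read a => (kexpr a).+1
  | Binop _ e1 e2 => (kexpr e1 + kexpr e2).*2
  end.

Definition bounded (b : nat) (s : state) : Prop :=
  (forall x, reg s x < 2 ^ b) /\ (forall a, mem s a < 2 ^ b).

Lemma kexpr_gt0 e : 0 < kexpr e.
Proof. by elim: e => //= o e1 H1 e2 H2; lia. Qed.

Lemma eval_binop_bound o x y c d :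
  0 < c -> 0 < d -> x < 2 ^ c -> y < 2 ^ d -> eval_binop o x y < 2 ^ (c + d).
Proof.
move=> c0 d0 xc yd; rewrite expnD.
have c2 : 2 <= 2 ^ c by rewrite -{1}(expn1 2) leq_exp2l.
have d2 : 2 <= 2 ^ d by rewrite -{1}(expn1 2) leq_exp2l.
have := leq_div x y; have := leq_mod x y.
by case: o => /=; try case: (_ <= _); try case: (_ == _); nia.
Qed.

Lemma eval_bound b s e : 0 < b -> bounded b s -> eval s e < 2 ^ (kexpr e * b).
Proof.
move=> b_gt0 [Hr Hm]; elim: e => [c | x | a _ | o e1 H1 e2 H2] /=.
- by apply: leq_trans (ltn_exp_bits c) _; rewrite leq_exp2l // leq_pmulr.
- by apply: leq_trans (Hr x) _; rewrite leq_exp2l // leq_pmull.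
- by apply: leq_trans (Hm _) _; rewrite leq_exp2l // leq_pmull.
have := eval_binop_bound o _ _ H1 H2; rewrite !muln_gt0 !kexpr_gt0 b_gt0 => /(_ isT isT).
by move/leq_trans; apply; rewrite leq_exp2l // -mulnDl leq_mul2r -addnn leq_addr orbT.
Qed.

Lemma cost_bound b s e : 0 < b -> bounded b s -> cost s e <= kexpr e * b.
Proof.
move=> b_gt0 Hs; elim: e => [c | x | a IH | o e1 H1 e2 H2] /=.
- by rewrite leq_pmulr.
- have : bits (reg s x) <= b by rewrite bits_leP //; case: Hs.
  by move: (bits x) (bits _) => u v; nia.
- have : bits (mem s (eval s a)) <= b by rewrite bits_leP //; case: Hs.
  by rewrite mulSn; lia.
have : bits (eval_binop o (eval s e1) (eval s e2)) <= (kexpr e1 + kexpr e2) * b.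
  rewrite bits_leP ?muln_gt0 ?b_gt0 ?addn_gt0 ?kexpr_gt0 // mulnDl.
  by apply: eval_binop_bound; rewrite ?muln_gt0 ?b_gt0 ?kexpr_gt0 ?eval_bound.
by rewrite -addnn; lia.
Qed.

Fixpoint loop_free (c : cmd) : bool :=
  match c with
  | Seq c1 c2 | If _ c1 c2 => loop_free c1 && loop_free c2
  | While _ _ => false
  | _ => true
  end.

(* Meaningful for loop-free commands only. *)
Fixpoint run (c : cmd) (s : state) : state :=
  match c with
  | Skip | While _ _ => s
  | Assign x e => State (update (reg s) x (eval s e)) (mem s)
  | Store a e => State (reg s) (update (mem s) (eval s a) (eval s e))
  | Seq c1 c2 => run c2 (run c1 s)
  | If e c1 c2 => if eval s e != 0 then run c1 s else run c2 s
  end.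

(* A loop-free command started in a state bounded by [2 ^ b] takes time at most
   [kcmd c * b] and ends in a state bounded by [2 ^ (kcmd c * b)]. *)
Fixpoint kcmd (c : cmd) : nat :=
  match c with
  | Skip | While _ _ => 1
  | Assign x e => bits x + kexpr e
  | Store a e => kexpr a + kexpr e
  | Seq c1 c2 => kcmd c1 + kcmd c2 * kcmd c1
  | If e c1 c2 => kexpr e + kcmd c1 + kcmd c2
  end.

Lemma kcmd_gt0 c : 0 < kcmd c.
Proof.
elim: c => //= *; rewrite ?addn_gt0 ?kexpr_gt0 ?orbT //.
by apply/orP; left.
Qed.

Lemma bounded_le b b' s : b <= b' -> bounded b s -> bounded b' s.
Proof.
move=> le_b [Hr Hm]; have le2: 2 ^ b <= 2 ^ b' by rewrite leq_exp2l.
by split=> x; apply: leq_trans le2.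
Qed.

Definition runs (c : cmd) (s : state) (T : nat) (s' : state) : Prop :=
  exists2 t, exec c s t s' & t <= T.

Lemma runs_loop_free b c s :
  0 < b -> loop_free c -> bounded b s ->
  runs c s (kcmd c * b) (run c s) /\ bounded (kcmd c * b) (run c s).
Proof.
elim: c b s => [|x e|a e|c1 IH1 c2 IH2|e c1 IH1 c2 IH2|//] b s b_gt0 /=.
- move=> _ Hs; rewrite mul1n; split=> //; exists 1 => //; exact: ExecSkip.
- move=> _ Hs; split.
    exists (bits x + cost s e); first exact: ExecAssign.
    by rewrite mulnDl leq_add ?cost_bound // leq_pmulr.
  have [Hr Hm] : bounded ((bits x + kexpr e) * b) s.
    by apply: bounded_le Hs; rewrite leq_pmull // addn_gt0.
  split=> y //=; rewrite /update; case: ifP => // _.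
  apply: leq_trans (eval_bound _ b_gt0 Hs) _.
  by rewrite leq_exp2l // leq_mul2r leq_addl orbT.
- move=> _ Hs; split.
    exists (cost s a + cost s e); first exact: ExecStore.
    by rewrite mulnDl leq_add ?cost_bound.
  have [Hr Hm] : bounded ((kexpr a + kexpr e) * b) s.
    by apply: bounded_le Hs; rewrite leq_pmull // addn_gt0 kexpr_gt0.
  split=> y //=; rewrite /update; case: ifP => // _.
  apply: leq_trans (eval_bound _ b_gt0 Hs) _.
  by rewrite leq_exp2l // leq_mul2r leq_addl orbT.
- case/andP=> L1 L2 Hs; have [[t1 E1 T1] B1] := IH1 _ _ b_gt0 L1 Hs.
  have b1_gt0 : 0 < kcmd c1 * b by rewrite muln_gt0 kcmd_gt0.
  have [[t2 E2 T2] B2] := IH2 _ _ b1_gt0 L2 B1; split.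
    exists (t1 + t2); first exact: ExecSeq E1 E2.
    by rewrite mulnDl -mulnA leq_add.
  by apply: bounded_le B2; rewrite mulnDl -mulnA leq_addl.
case/andP=> L1 L2 Hs; case: eqP => [e0 | /eqP e1] /=.
  have [[t E T] B] := IH2 _ _ b_gt0 L2 Hs; split.
    exists (cost s e + t); first exact: ExecIfFalse.
    by rewrite !mulnDl -addnA leq_add ?cost_bound // (leq_trans T) // leq_addl.
  by apply: bounded_le B; rewrite mulnDl leq_addl.
have [[t E T] B] := IH1 _ _ b_gt0 L1 Hs; split.
  exists (cost s e + t); first exact: ExecIfTrue.
  by rewrite !mulnDl -addnA leq_add ?cost_bound // (leq_trans T) // leq_addr.
by apply: bounded_le B; rewrite leq_mul2r addnAC leq_addl orbT.
Qed.

Lemma runs_run b c s s' :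
  0 < b -> loop_free c -> bounded b s -> run c s = s' -> runs c s (kcmd c * b) s'.
Proof. by move=> b0 L B <-; case: (runs_loop_free b0 L B). Qed.

Lemma runs_seq c1 c2 s1 s2 s3 T1 T2 :
  runs c1 s1 T1 s2 -> runs c2 s2 T2 s3 -> runs (Seq c1 c2) s1 (T1 + T2) s3.
Proof.
by move=> [t1 E1 H1] [t2 E2 H2]; exists (t1 + t2); [exact: ExecSeq E1 E2 | exact: leq_add].
Qed.

Lemma runs_le c s s' T T' : T <= T' -> runs c s T s' -> runs c s T' s'.
Proof. by move=> le [t E H]; exists t => //; exact: leq_trans le. Qed.

Lemma runs_if b e c1 c2 s s' T :
  0 < b -> bounded b s ->
  runs (if eval s e != 0 then c1 else c2) s T s' ->
  runs (If e c1 c2) s (kexpr e * b + T) s'.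
Proof.
move=> b0 Hs; case: eqP => [e0 | /eqP e1] /= [t E H]; exists (cost s e + t);
  rewrite ?leq_add ?cost_bound //; [exact: ExecIfFalse | exact: ExecIfTrue].
Qed.

(* The index [k] of the invariant bounds the number of remaining iterations. *)
Lemma runs_while b e c Nc (P : nat -> state -> Prop) :
  0 < b ->
  (forall k s, P k s -> bounded b s) ->
  (forall k s, P k s -> eval s e != 0 ->
     0 < k /\ exists2 s', runs c s (Nc * b) s' & P k.-1 s') ->
  forall k s, P k s ->
  exists2 s', runs (While e c) s ((k * (Nc + kexpr e) + kexpr e) * b) s'
            & exists2 k', P k' s' & eval s' e = 0.
Proof.
move=> b0 HB Hstep; elim=> [|k IH] s Ps.
  have [e0 | e1] := eqVneq (eval s e) 0; last by case: (Hstep _ _ Ps e1).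
  exists s; last by exists 0.
  exists (cost s e); first exact: ExecWhileFalse.
  by rewrite add0n cost_bound //; apply: HB Ps.
have Bs := HB _ _ Ps; have [e0 | e1] := eqVneq (eval s e) 0.
  exists s; last by exists k.+1.
  exists (cost s e); first exact: ExecWhileFalse.
  by apply: leq_trans (cost_bound e b0 Bs) _; rewrite leq_mul2r leq_addl orbT.
have [_ [s1 [t1 E1 H1] P1]] := Hstep _ _ Ps e1.
have [s2 [t2 E2 H2] P2] := IH _ P1.
exists s2 => //; exists (cost s e + t1 + t2); first exact: ExecWhileTrue E1 E2.
have := cost_bound e b0 Bs; move: (cost s e) (kexpr e) H1 H2 => w q; nia.
Qed.

(** Here the index counts the iterations done, and [A - i] serves as the decreasing index of
    [runs_while]. The condition decides [i < A] exactly, which forces the final index to be [A]. *)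
Lemma runs_for b e c Nc A (P : nat -> state -> Prop) :
  0 < b ->
  (forall i s, P i s -> bounded b s) ->
  (forall i s, i <= A -> P i s -> (eval s e != 0) = (i < A)) ->
  (forall i s, i < A -> P i s -> exists2 s', runs c s (Nc * b) s' & P i.+1 s') ->
  forall s, P 0 s ->
  exists2 s', runs (While e c) s ((A * (Nc + kexpr e) + kexpr e) * b) s' & P A s'.
Proof.
move=> b0 HB Hcond Hstep s Ps.
pose Q k s := k <= A /\ P (A - k) s.
have Qstep k s' : Q k s' -> eval s' e != 0 ->
    0 < k /\ exists2 s2, runs c s' (Nc * b) s2 & Q k.-1 s2.
  move=> [le_k Pk] e1; have := Hcond _ _ (leq_subr k A) Pk.
  rewrite e1 => /esym lt_k; have k0 : 0 < k by lia.
  split=> //; have [s2 R2 P2] := Hstep _ _ lt_k Pk; exists s2 => //.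
  split; first lia.
  by have -> : A - k.-1 = (A - k).+1 by lia.
have QA : Q A s by rewrite /Q leqnn subnn.
have [s' R [k' [le_k Pk] e0]] :=
  runs_while b0 (fun k s' => fun H : Q k s' => HB _ _ H.2) Qstep QA.
exists s' => //; have := Hcond _ _ (leq_subr k' A) Pk.
rewrite e0 eqxx => /esym H; have k0 : k' = 0 by lia.
by rewrite k0 subn0 in Pk.
Qed.

(** * Derived expressions *)

Declare Scope expr_scope.
Delimit Scope expr_scope with X.
Notation "a + b" := (Binop Add a b) : expr_scope.
Notation "a - b" := (Binop Sub a b) : expr_scope.
Notation "a * b" := (Binop Mul a b) : expr_scope.
Notation "a %/ b" := (Binop Div a b) : expr_scope.
Notation "a %% b" := (Binop Mod a b) : expr_scope.
Notation "a <= b" := (Binop Leq a b) : expr_scope.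
Notation "a == b" := (Binop Eq a b) : expr_scope.
Notation "a < b" := (Binop Leq (Binop Add a (Const 1)) b) : expr_scope.

(** Both branches are evaluated, which is harmless as evaluation is total and costs only a constant
    factor. Thus a whole step of the dynamic program becomes one expression, and the loop that fills
    the table has a loop-free body. *)
Definition cond (c a b : expr) : expr :=
  ((Const 0 < c) * a + (c <= Const 0) * b)%X.

Fixpoint esum (g : nat -> expr) (k : nat) : expr :=
  if k is k'.+1 then (esum g k' + g k')%X else Const 0.

Fixpoint epow (e : expr) (k : nat) : expr :=
  if k is k'.+1 then (e * epow e k')%X else Const 1.

Fixpoint epick (g : nat -> expr) (k : nat) : expr :=
  if k is k'.+1 then cond (g k') (Const k) (epick g k') else Const 0.

(* One plus some index below [k] satisfying [f], or 0 if there is none. *)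
Fixpoint pick_below (f : nat -> bool) (k : nat) : nat :=
  if k is k'.+1 then if f k' then k else pick_below f k' else 0.

Lemma pick_below_le (f : nat -> bool) k : pick_below f k <= k.
Proof. by elim: k => //= k IH; case: ifP => // _; apply: leqW. Qed.

Lemma pick_belowP (f : nat -> bool) k : 0 < pick_below f k -> f (pick_below f k).-1.
Proof. by elim: k => //= k IH; case: ifP. Qed.

Lemma pick_below_gt0 (f : nat -> bool) k i : i < k -> f i -> 0 < pick_below f k.
Proof.
elim: k => //= k IH; rewrite ltnS leq_eqVlt; case: ifP => // fk.
by case/orP => [/eqP -> | /IH //]; rewrite fk.
Qed.

Lemma eq_pick_below (f g : nat -> bool) k :
  (forall i, i < k -> f i = g i) -> pick_below f k = pick_below g k.
Proof.
elim: k => //= k IH H; rewrite H // IH // => i Hi; apply: H; exact: leqW.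
Qed.

Lemma eval_const s c : eval s (Const c) = c. Proof. by []. Qed.
Lemma eval_reg s x : eval s (Reg x) = reg s x. Proof. by []. Qed.
Lemma eval_read s e : eval s (Read e) = mem s (eval s e). Proof. by []. Qed.
Lemma eval_add s e f : eval s (e + f)%X = eval s e + eval s f. Proof. by []. Qed.
Lemma eval_sub s e f : eval s (e - f)%X = eval s e - eval s f. Proof. by []. Qed.
Lemma eval_mul s e f : eval s (e * f)%X = eval s e * eval s f. Proof. by []. Qed.
Lemma eval_div s e f : eval s (e %/ f)%X = eval s e %/ eval s f. Proof. by []. Qed.
Lemma eval_mod s e f : eval s (e %% f)%X = eval s e %% eval s f. Proof. by []. Qed.
Lemma eval_leq s e f : eval s (e <= f)%X = (eval s e <= eval s f). Proof. by []. Qed.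
Lemma eval_eq s e f : eval s (e == f)%X = (eval s e == eval s f). Proof. by []. Qed.
Lemma eval_ltn s e f : eval s (e < f)%X = (eval s e < eval s f).
Proof. by rewrite /= addn1. Qed.

Lemma eval_cond s c a b :
  eval s (cond c a b) = if 0 < eval s c then eval s a else eval s b.
Proof.
rewrite /cond eval_add !eval_mul eval_ltn eval_leq !eval_const.
by case: (eval s c) => [|k]; rewrite ?mul1n ?mul0n ?addn0.
Qed.

Lemma eval_sum s g k : eval s (esum g k) = \sum_(i < k) eval s (g i).
Proof. by elim: k => [|k IH]; rewrite ?big_ord0 // big_ord_recr /= IH. Qed.

Lemma eval_pow s e k : eval s (epow e k) = eval s e ^ k.
Proof. by elim: k => //= k ->; rewrite expnS. Qed.

Lemma eval_pick s g k : eval s (epick g k) = pick_below (fun i => 0 < eval s (g i)) k.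
Proof.
elim: k => // k IH.
by rewrite -[epick g k.+1]/(cond (g k) (Const k.+1) (epick g k)) eval_cond IH.
Qed.

Definition evalE := (eval_const, eval_reg, eval_read, eval_add, eval_sub, eval_mul,
  eval_div, eval_mod, eval_ltn, eval_leq, eval_eq, eval_cond, eval_sum, eval_pow, eval_pick).

Arguments eval : simpl never.
Arguments kexpr : simpl never.
Arguments kcmd : simpl never.

(** * Bundling equal jobs *)

Lemma exists_le_sum (I : finType) (f : I -> nat) s :
  s <= \sum_i f i -> exists2 g : I -> nat, (forall i, g i <= f i) & \sum_i g i = s.
Proof.
elim: s => [|s IH] le_s; first by exists (fun=> 0) => //; rewrite big1.
have [g le_g sum_g] := IH (ltnW le_s).
have [i lt_i] : exists i, g i < f i.
  apply/existsP; apply: contraLR le_s; rewrite -leqNgt => /existsPn H.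
  by rewrite -sum_g leq_sum // => i _; rewrite leqNgt.
exists (fun j => g j + (j == i)) => [j|].
  by have [-> | _] := eqVneq; rewrite ?addn1 ?addn0.
rewrite big_split /= sum_g (bigD1 i) //= eqxx big1 ?addn0 ?addn1 // => j.
by case: eqP.
Qed.

Lemma exists_fibres m (f : 'I_m -> nat) : 0 < m ->
  exists a : nat -> 'I_m,
    forall i, f i = \sum_(s < \sum_j f j) (a s == i).
Proof.
case: m f => // m f _.
pose S := flatten [seq nseq (f i) i | i <- enum 'I_m.+1].
have sizeS : size S = \sum_j f j.
  rewrite size_flatten /shape -map_comp sumnE big_map big_enum /=.
  by apply: eq_bigr => i _; rewrite size_nseq.
exists (nth ord0 S) => i; rewrite -sizeS.
transitivity (count_mem i S).
  rewrite count_flatten -map_comp sumnE big_map big_enum /= (bigD1 i) //=.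
  rewrite count_nseq /= eqxx mul1n big1 ?addn0 // => j /negPf ne.
  by rewrite count_nseq /= ne.
rewrite -sum1_count big_mkcond /= (big_nth ord0) big_mkord.
by apply: eq_bigr => s _; case: eqP.
Qed.

(** This is [(x - m) / 2] rounded up; as subtraction is truncated, no pairs are formed when
    [x <= m]. *)
Definition half (m x : nat) : nat := (x - m + 1) %/ 2.

(* Halving the entries of [f] loses at most one job per machine, so at least
   [half m (\sum_i f i)] pairs can be formed whatever [f] is. *)
Lemma exists_half m (f : 'I_m -> nat) :
  exists2 g : 'I_m -> nat, (forall i, 2 * g i <= f i)
    & \sum_i g i = half m (\sum_i f i).
Proof.
have le_half : half m (\sum_i f i) <= \sum_i (f i)./2.
  have : \sum_i f i <= \sum_i (2 * (f i)./2 + 1).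
    by apply: leq_sum => i _; rewrite mul2n -{1}(odd_double_half (f i)); case: odd; lia.
  rewrite big_split /= -big_distrr /= sum1_card card_ord /half.
  by move: (\sum_i f i) (\sum_i (f i)./2) => x y; lia.
have [g le_g sum_g] := exists_le_sum le_half.
exists g => // i; have := le_g i.
by rewrite -{2}(odd_double_half (f i)) -mul2n; lia.
Qed.

Lemma half_le m x : 0 < m -> 2 * half m x <= x.
Proof. by rewrite /half; lia. Qed.

Lemma half_ge m x : x <= 2 * half m x + m.
Proof. by rewrite /half; lia. Qed.

(** The number of groups of [2 ^ k] jobs formed out of [x] jobs. Of these, [2 * halves m x k.+1] are
    merged in pairs, and the others are the final bundles of [2 ^ k] jobs. *)
Definition halves (m x k : nat) : nat := iter k (half m) x.

Arguments halves : simpl never.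

Lemma halvesS m x k : halves m x k.+1 = half m (halves m x k).
Proof. by []. Qed.

Lemma halvesSr m x k : halves m x k.+1 = halves m (half m x) k.
Proof. exact: iterSr. Qed.

Lemma halves_bound m x k : 0 < m -> 2 ^ k * halves m x k <= x.
Proof.
move=> m0; elim: k x => [|k IH] x; first by rewrite mul1n.
by rewrite halvesSr; have := IH (half m x); have := half_le x m0; rewrite expnS; nia.
Qed.

Lemma halves_eq0 m x k : 0 < m -> x < 2 ^ k -> halves m x k = 0.
Proof.
move=> m0 lt_x; apply/eqP; rewrite -leqn0 leqNgt; apply/negP => h0.
by have := halves_bound x k m0; nia.
Qed.

Lemma sum_bundles m x k : 0 < m ->
  \sum_(j < k) 2 ^ j * (halves m x j - 2 * halves m x j.+1) + 2 ^ k * halves m x k = x.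
Proof.
move=> m0; elim: k => [|k IH]; first by rewrite big_ord0 mul1n.
rewrite big_ord_recr /= -addnA -[RHS]IH; congr (_ + _).
by rewrite expnSr -mulnA -mulnDr subnK // half_le.
Qed.

(** The numbers of bundles depend on [x] only, while [a] depends on the distribution [f]. By
    [exists_half], [f] splits into pairs [g] whose total is [half m x], and single jobs
    [f i - 2 * g i]; the single jobs are the bundles of level 0, and the induction hypothesis for
    [g] provides the other levels. *)
Lemma exists_bundling m k x (f : 'I_m -> nat) :
  0 < m -> \sum_i f i = x -> halves m x k = 0 ->
  exists a : nat -> nat -> 'I_m, forall i,
    f i = \sum_(j < k) 2 ^ j * \sum_(s < halves m x j - 2 * halves m x j.+1) (a j s == i).
Proof.
move=> m0; elim: k x f => [|k IH] x f sum_f h0.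
  exists (fun _ _ => Ordinal m0) => i; rewrite big_ord0; apply/eqP.
  by rewrite -leqn0 -[X in _ <= X]h0 -[X in _ <= X]sum_f (bigD1 i) //= leq_addr.
have [g le_g sum_g] := exists_half f.
have [a Ha] := exists_fibres (fun i => f i - 2 * g i) m0.
have sum_r : \sum_i (f i - 2 * g i) = x - 2 * half m x.
  have: \sum_i (f i - 2 * g i) + 2 * \sum_i g i = x.
    by rewrite big_distrr -big_split -sum_f; apply: eq_bigr => i _ /=; rewrite subnK.
  by rewrite sum_g sum_f => sum_x; rewrite -[in X in X - _]sum_x addnK.
rewrite sum_f in sum_g; rewrite halvesSr in h0.
have [a' Ha'] := IH _ _ sum_g h0.
exists (fun j => if j is j'.+1 then a' j' else a) => i.
rewrite big_ord_recl /= expn0 mul1n -sum_r -Ha.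
rewrite -[LHS](subnK (le_g i)); congr (_ + _); rewrite {1}Ha' big_distrr /=.
by apply: eq_bigr => j _; rewrite mulnA -expnS !halvesSr.
Qed.

(** * Digits *)

Definition dig (B i u : nat) : nat := u %/ B ^ i %% B.

(** There is no borrow, because [q] does not exceed the digit from which it is subtracted. *)
Lemma dig_subX B i j u q :
  0 < B -> q <= dig B i u -> dig B j (u - q * B ^ i) = dig B j u - (i == j) * q.
Proof.
move=> B0 le_q; have Bi j' : 0 < B ^ j' by rewrite expn_gt0 B0.
have le_u : q * B ^ i <= u.
  rewrite -leq_divRL //; apply: leq_trans le_q _; exact: leq_mod.
set v := u - _; have Eu : u = q * B ^ i + v by rewrite /v subnKC.
have Edi : v %/ B ^ i = u %/ B ^ i - q by rewrite Eu divnMDl // addKn.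
have le_q' : q <= u %/ B ^ i by rewrite Eu divnMDl // leq_addr.
have lt_B : u %/ B ^ i %% B - q < B.
  by apply: leq_ltn_trans (leq_subr _ _) _; exact: ltn_pmod.
have Esub : u %/ B ^ i - q = u %/ B ^ i %/ B * B + (u %/ B ^ i %% B - q).
  by rewrite {1}(divn_eq (u %/ B ^ i) B) -addnBA.
rewrite /dig; case: (ltngtP i j) => [lt_ij | lt_ji | <-] /=; rewrite ?mul0n ?subn0 ?mul1n.
- have E w : w %/ B ^ j = w %/ B ^ i %/ B %/ B ^ (j - i.+1).
    by rewrite -!divnMA -expnS -expnD addnS -addSn subnKC.
  by rewrite !E Edi Esub divnMDl // [X in _ + X]divn_small ?addn0.
- rewrite [in RHS]Eu.
  have -> : q * B ^ i = q * B ^ (i - j.+1) * B * B ^ j.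
    by rewrite -[_ * B * _]mulnA -expnS -mulnA -expnD subnK.
  by rewrite divnMDl // modnMDl.
by rewrite Edi Esub modnMDl modn_small.
Qed.

Lemma sum_digits_lt B m (v : nat -> nat) :
  (forall i, i < m -> v i < B) -> \sum_(i < m) v i * B ^ i < B ^ m.
Proof.
elim: m => [|m IH] Hv; first by rewrite big_ord0.
rewrite big_ord_recr /= expnS.
have := IH (fun i lt => Hv i (ltnW lt)); have := Hv _ (ltnSn m).
by move: (\sum_(i < m) _) => x; nia.
Qed.

Lemma dig_sum B m (v : nat -> nat) i :
  (forall i, i < m -> v i < B) -> i < m -> dig B i (\sum_(j < m) v j * B ^ j) = v i.
Proof.
elim: m => // m IH Hv; rewrite ltnS leq_eqVlt big_ord_recr /= => le_i.
have Hv' j : j < m -> v j < B by move=> lt; apply: Hv; exact: ltnW.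
have B0 : 0 < B by apply: leq_ltn_trans (Hv m (ltnSn m)).
have Bj j : 0 < B ^ j by rewrite expn_gt0 B0.
case/orP: le_i => [/eqP -> | lt_i].
  by rewrite /dig addnC divnMDl // divn_small ?addn0 ?modn_small ?Hv // sum_digits_lt.
have -> : v m * B ^ m = v m * B ^ (m - i.+1) * B * B ^ i.
  by rewrite -[_ * B * _]mulnA -expnS -mulnA -expnD subnK.
by rewrite -[RHS](IH Hv' lt_i) /dig addnC divnMDl // modnMDl.
Qed.

Lemma sum_nat_flat (F : nat -> nat) a b :
  \sum_(l < a * b) F l = \sum_(i < a) \sum_(j < b) F (i * b + j).
Proof.
elim: a => [|a IH]; first by rewrite mul0n !big_ord0.
rewrite big_ord_recr /= -IH mulSnr -[LHS](big_mkord xpredT F).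
rewrite (big_cat_nat (leq0n (a * b)) (leq_addr b (a * b))) big_mkord /=; congr (_ + _).
rewrite -{1}[a * b]add0n big_addn addKn big_mkord.
by apply: eq_bigr => j _; rewrite addnC.
Qed.

Lemma leq_sum_prefix (F : nat -> nat) a b : a <= b -> \sum_(l < a) F l <= \sum_(l < b) F l.
Proof.
move=> le_ab; rewrite -!(big_mkord xpredT) (big_cat_nat (leq0n a) le_ab) /=.
exact: leq_addr.
Qed.

Lemma sum_ord_lt (F : nat -> nat) r m :
  r <= m -> \sum_(s < m) (s < r) * F s = \sum_(s < r) F s.
Proof.
move=> le_r; rewrite -(big_mkord xpredT (fun s => (s < r) * F s)) -(big_mkord xpredT F).
rewrite (big_cat_nat (leq0n r) le_r) /=.
rewrite [X in _ + X]big1_seq ?addn0; last first.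
  by move=> s; rewrite mem_index_iota andTb => /andP[le_s _]; rewrite ltnNge le_s.
by rewrite !big_mkord; apply: eq_bigr => s _; rewrite ltn_ord mul1n.
Qed.

(** * The dynamic program *)

Section DynamicProgram.

(* A job type is [T = size + Q * mask] with [size < Q], where the bits of [mask] are
   the machines that accept the job.  There are [Nc T] jobs of type [T], all
   processing times are below [Q], and [C] is the makespan that is aimed at. *)
Variables (m Q K : nat) (Nc : nat -> nat).

Definition ntypes : nat := 2 ^ m * Q.
Definition nslots : nat := ntypes * m.
Definition nlayers : nat := nslots.+1.
Definition cap_max : nat := 2 * nslots * Q.
Definition base : nat := cap_max.+1.
Definition nstates : nat := base ^ m.

Definition flag (T i : nat) : nat := T %/ Q %/ 2 ^ i %% 2.
Definition psize (T : nat) : nat := T %% Q.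

(* Layer [l] belongs to level [lev l].  The first [nslots] layers of a level are
   slots for bundles of [2 ^ lev l] jobs, [m] for each type, of which only the
   active ones are used; the last one passes to the next level. *)
Definition lev (l : nat) : nat := l %/ nlayers.
Definition pos (l : nat) : nat := l %% nlayers.
Definition typ (l : nat) : nat := pos l %/ m.
Definition active (l : nat) : bool :=
  pos l %% m + 2 * halves m (Nc (typ l)) (lev l).+1 < halves m (Nc (typ l)) (lev l).

(* The digits of a state [u] are the remaining capacities of the machines in
   units of [2 ^ lev l], rounded down and truncated to [cap_max]. *)
Definition refine (C l u : nat) : nat :=
  \sum_(i < m) minn cap_max (2 * dig base i u + C %/ 2 ^ lev l %% 2) * base ^ i.

Definition fits (g : nat -> nat) (l u i : nat) : bool :=
  [&& 0 < flag (typ l) i, psize (typ l) <= dig base i u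
    & 0 < g (u - psize (typ l) * base ^ i)].

Definition dp_step (C l : nat) (g : nat -> nat) (u : nat) : nat :=
  if pos l < nslots then
    if active l then pick_below (fits g l u) m else g u
  else g (refine C l u).

(* [dp C l u] is positive if the bundles of the layers below [l] can be scheduled
   in the capacities [u]; in an active slot it is one plus the machine to use. *)
Fixpoint dp (C l u : nat) : nat :=
  if l is l'.+1 then dp_step C l' (dp C l') u else 1.

Definition dp_start (C : nat) : nat :=
  \sum_(i < m) minn cap_max (C %/ 2 ^ K) * base ^ i.

Hypotheses (m_gt0 : 0 < m) (Q_gt0 : 0 < Q).
Hypothesis Nc_lt : forall T, T < ntypes -> Nc T < 2 ^ K.

Lemma ntypes_gt0 : 0 < ntypes.
Proof. by rewrite /ntypes muln_gt0 expn_gt0. Qed.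

Lemma base_exp_gt0 i : 0 < base ^ i. Proof. by rewrite expn_gt0. Qed.
Lemma minn_base x : minn cap_max x < base. Proof. by rewrite ltnS geq_minl. Qed.

Lemma lev_block k q : q < nlayers -> lev (k * nlayers + q) = k.
Proof. by move=> lt_q; rewrite /lev divnMDl // divn_small ?addn0. Qed.

Lemma pos_block k q : q < nlayers -> pos (k * nlayers + q) = q.
Proof. by move=> lt_q; rewrite /pos modnMDl modn_small. Qed.

Lemma lev_S l : lev l.+1 = if pos l < nslots then lev l else (lev l).+1.
Proof.
rewrite {1}/lev {1}(divn_eq l nlayers) -addnS; case: ifP => lt_p.
  by rewrite divnMDl // [X in _ + X]divn_small ?addn0 //; exact: lt_p.
have -> : (l %% nlayers).+1 = nlayers.
  by apply/eqP; rewrite eqn_leq ltn_pmod //= /nlayers ltnS leqNgt lt_p.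
by rewrite divnMDl // divnn addn1.
Qed.

Lemma pos_le l : pos l <= nslots.
Proof. by rewrite -ltnS ltn_pmod. Qed.

Lemma pos_S l : pos l.+1 = if pos l < nslots then (pos l).+1 else 0.
Proof.
rewrite {1}/pos {1}(divn_eq l nlayers) -addnS modnMDl; case: ifP => lt_p.
  by rewrite modn_small.
have -> : (l %% nlayers).+1 = nlayers.
  by apply/eqP; rewrite eqn_leq ltn_pmod //= /nlayers ltnS leqNgt lt_p.
by rewrite modnn.
Qed.

(** A geometric sum. As [pos l <= nslots], the slots below layer [l] hold at most
    [2 * nslots * 2 ^ lev l] jobs, whence the factor 2 in [cap_max]. *)
Lemma sum_slots l :
  \sum_(l' < l) (pos l' < nslots) * 2 ^ lev l' + nslots
  = nslots * 2 ^ lev l + 2 ^ lev l * pos l.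
Proof.
elim: l => [|l IH]; first by rewrite big_ord0 /lev /pos div0n mod0n !muln1 addn0.
rewrite big_ord_recr /= addnAC IH lev_S pos_S; have := pos_le l.
by case: ltnP => [lt_p _ | le1 le2]; rewrite ?expnS; nia.
Qed.

Lemma typ_lt l : pos l < nslots -> typ l < ntypes.
Proof. by move=> lt_p; rewrite /typ ltn_divLR. Qed.

Lemma slot_lt T s : T < ntypes -> s < m -> T * m + s < nslots.
Proof. by rewrite /nslots; nia. Qed.

Lemma lev_slot k T s : T < ntypes -> s < m -> lev (k * nlayers + (T * m + s)) = k.
Proof. by move=> lt_T lt_s; apply: lev_block; exact: ltnW (slot_lt lt_T lt_s). Qed.

Lemma pos_slot k T s : T < ntypes -> s < m ->
  pos (k * nlayers + (T * m + s)) = T * m + s.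
Proof. by move=> lt_T lt_s; apply: pos_block; exact: ltnW (slot_lt lt_T lt_s). Qed.

Lemma sum_layers (F : nat -> nat) :
  (forall l, ~~ (pos l < nslots) -> F l = 0) ->
  \sum_(l < K * nlayers) F l =
  \sum_(k < K) \sum_(T < ntypes) \sum_(s < m) F (k * nlayers + (T * m + s)).
Proof.
move=> F0; rewrite sum_nat_flat; apply: eq_bigr => k _.
rewrite /nlayers big_ord_recr /= F0 ?addn0; last by rewrite pos_block ?ltnn.
by rewrite (sum_nat_flat (fun q => F (k * nlayers + q))).
Qed.

Lemma active_block k T s : T < ntypes -> s < m ->
  active (k * nlayers + (T * m + s)) =
  (s < halves m (Nc T) k - 2 * halves m (Nc T) k.+1).
Proof.
move=> lt_T lt_s; rewrite /active /typ lev_slot // pos_slot // modnMDl modn_small //.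
by rewrite divnMDl // divn_small // addn0; lia.
Qed.

Lemma typ_block k T s : T < ntypes -> s < m -> typ (k * nlayers + (T * m + s)) = T.
Proof.
move=> lt_T lt_s; by rewrite /typ pos_slot // divnMDl // divn_small // addn0.
Qed.

(** * Correctness of the dynamic program *)

(** The amount of time that a state stands for: whole units of [2 ^ lev l], and the residue of [C],
    which bundles of at least [2 ^ lev l] jobs leave untouched. *)
Definition capacity (C l u i : nat) : nat :=
  2 ^ lev l * dig base i u + C %% 2 ^ lev l.

Lemma refine_lt C l u : refine C l u < nstates.
Proof.
apply: (sum_digits_lt (v := fun i => minn cap_max (2 * dig base i u + C %/ 2 ^ lev l %% 2))) => i _.
exact: minn_base.
Qed.

Lemma dig_refine C l u i : i < m ->
  dig base i (refine C l u) = minn cap_max (2 * dig base i u + C %/ 2 ^ lev l %% 2).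
Proof.
apply: (dig_sum (v := fun i => minn cap_max (2 * dig base i u + _))) => j _.
exact: minn_base.
Qed.

Lemma dp_start_lt C : dp_start C < nstates.
Proof.
by apply: (sum_digits_lt (v := fun=> minn cap_max (C %/ 2 ^ K))) => i _; exact: minn_base.
Qed.

Lemma dig_start C i : i < m -> dig base i (dp_start C) = minn cap_max (C %/ 2 ^ K).
Proof. by apply: (dig_sum (v := fun i => minn cap_max _)) => j _; exact: minn_base. Qed.

Lemma capacity_S C l u i : pos l < nslots -> capacity C l.+1 u i = capacity C l u i.
Proof. by rewrite /capacity lev_S => ->. Qed.

Lemma capacity_sub C l u i j q : q <= dig base j u ->
  capacity C l (u - q * base ^ j) i + (j == i) * (2 ^ lev l * q) = capacity C l u i.
Proof.
move=> le_q; rewrite /capacity dig_subX // addnAC; congr (_ + _).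
by case: eqP le_q => [<- | _] le_q; rewrite ?subn0 ?addn0 // !mul1n -mulnDr subnK.
Qed.

(** On entering the lower level, one binary digit of [C] moves from the residue to the units; up to
    truncation, the capacity is unchanged. *)
Lemma capacity_refined C l u i : ~~ (pos l < nslots) ->
  capacity C l.+1 u i =
  2 ^ lev l * (2 * dig base i u + C %/ 2 ^ lev l %% 2) + C %% 2 ^ lev l.
Proof.
rewrite /capacity lev_S => /negPf ->; set e := 2 ^ lev l.
rewrite expnS -/e; have e0 : 0 < e by rewrite expn_gt0.
have -> : C %% (2 * e) = C %/ e %% 2 * e + C %% e.
  rewrite {1}(divn_eq C e) {1}(divn_eq (C %/ e) 2) mulnDl -mulnA -addnA modnMDl.
  rewrite modn_small //; have := ltn_pmod C e0.
  by have := ltn_pmod (C %/ e) (isT : 0 < 2); nia.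
by rewrite mulnDr; lia.
Qed.

(** Truncation can only decrease a capacity, so it never makes the dynamic program succeed
    wrongly. *)
Lemma capacity_refine_le C l u i : i < m -> ~~ (pos l < nslots) ->
  capacity C l (refine C l u) i <= capacity C l.+1 u i.
Proof.
move=> lt_i le_p; rewrite capacity_refined // /capacity dig_refine //.
by rewrite leq_add2r leq_mul2l geq_minr orbT.
Qed.

Lemma capacity_start C i : i < m -> capacity C (K * nlayers) (dp_start C) i <= C.
Proof.
move=> lt_i; rewrite /capacity /lev mulnK // dig_start // {3}(divn_eq C (2 ^ K)).
by rewrite leq_add2r mulnC leq_mul2r geq_minr orbT.
Qed.

Definition rest (l T : nat) : nat :=
  \sum_(l' < l) [&& pos l' < nslots, active l' & typ l' == T] * 2 ^ lev l'.

Lemma slots_le T k : halves m (Nc T) k - 2 * halves m (Nc T) k.+1 <= m.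
Proof. by have := half_ge m (halves m (Nc T) k); rewrite halvesS; lia. Qed.

(** No group of [2 ^ K] jobs exists because [Nc T < 2 ^ K], and [m] slots per type and level hold
    all bundles by [slots_le]; so the active slots account for every job. *)
Lemma rest_all T : T < ntypes -> rest (K * nlayers) T = Nc T.
Proof.
move=> lt_T; rewrite /rest.
rewrite (sum_layers
  (F := fun l => [&& pos l < nslots, active l & typ l == T] * 2 ^ lev l)); last first.
  by move=> l; case: (pos l < nslots).
rewrite -[RHS](sum_bundles _ K m_gt0) halves_eq0 ?Nc_lt // muln0 addn0.
apply: eq_bigr => k _; rewrite (bigD1 (Ordinal lt_T)) //= [X in _ + X]big1 ?addn0.
  transitivity (2 ^ k * \sum_(s < m) (s < halves m (Nc T) k - 2 * halves m (Nc T) k.+1) * 1).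
    rewrite big_distrr; apply: eq_bigr => s _ /=.
    rewrite pos_slot // lev_slot //.
    by rewrite active_block // typ_block // slot_lt //= eqxx andbT muln1 mulnC.
  by rewrite (sum_ord_lt (fun=> 1)) ?slots_le // sum1_card card_ord.
move=> T' ne; rewrite big1 // => s _; rewrite typ_block // (_ : _ == T = false) ?andbF //.
by apply: contraNF ne => /eqP E; apply/eqP/val_inj.
Qed.

Lemma rest_S l T : rest l.+1 T =
  rest l T + [&& pos l < nslots, active l & typ l == T] * 2 ^ lev l.
Proof. by rewrite /rest big_ord_recr. Qed.

(* [X (T * m + i)] jobs of type [T] have been assigned to machine [i]. *)
Record partial (C l u : nat) (X : nat -> nat) : Prop := Partial {
  partial_dp : 0 < dp C l u;
  partial_lt : u < nstates;
  partial_cap : forall i, i < m ->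
    \sum_(T < ntypes) psize T * X (T * m + i) + capacity C l u i <= C;
  partial_rest : forall T, T < ntypes ->
    \sum_(i < m) X (T * m + i) + rest l T = Nc T;
  partial_flag : forall T i, T < ntypes -> i < m -> 0 < X (T * m + i) -> 0 < flag T i }.

Lemma partial_init C : 0 < dp C (K * nlayers) (dp_start C) ->
  partial C (K * nlayers) (dp_start C) (fun=> 0).
Proof.
move=> dp0; split=> // [|i lt_i|T lt_T].
- exact: dp_start_lt.
- by rewrite big1 ?capacity_start // => T _; rewrite muln0.
- by rewrite big1 ?rest_all.
Qed.

Lemma partial_eq C l u X Y : (forall a, a < nslots -> X a = Y a) ->
  partial C l u X -> partial C l u Y.
Proof.
move=> E [H1 H2 H3 H4 H5]; split=> // [i lt_i | T lt_T | T i lt_T lt_i].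
- by under eq_bigr => T _ do rewrite -E ?slot_lt //; exact: H3.
- by under eq_bigr => i _ do rewrite -E ?slot_lt //; exact: H4.
- by rewrite -E ?slot_lt //; exact: H5.
Qed.

Lemma partial_refine C l u X : ~~ (pos l < nslots) ->
  partial C l.+1 u X -> partial C l (refine C l u) X.
Proof.
move=> le_p [H1 H2 H3 H4 H5]; split=> // [||i lt_i|T lt_T].
- by move: H1; rewrite /= /dp_step (negPf le_p).
- exact: refine_lt.
- by apply: leq_trans (H3 i lt_i); rewrite leq_add2l capacity_refine_le.
- by have := H4 T lt_T; rewrite rest_S (negPf le_p) addn0.
Qed.

Lemma partial_skip C l u X : pos l < nslots -> ~~ active l ->
  partial C l.+1 u X -> partial C l u X.
Proof.
move=> lt_p inact [H1 H2 H3 H4 H5]; split=> // [|i lt_i|T lt_T].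
- by move: H1; rewrite /= /dp_step lt_p (negPf inact).
- by rewrite -capacity_S ?H3.
- by have := H4 T lt_T; rewrite rest_S (negPf inact) andbF addn0.
Qed.

Lemma slot_inj T T' i i' : i < m -> i' < m -> (T * m + i == T' * m + i') = (T == T') && (i == i').
Proof.
move=> lt_i lt_i'; apply/eqP/andP => [E | [/eqP -> /eqP -> //]].
have := congr1 (divn^~ m) E; have := congr1 (modn^~ m) E.
by rewrite /= !modnMDl !divnMDl // !modn_small // !divn_small // !addn0 => -> ->.
Qed.

(** A positive entry of an active slot names a machine that passed the test [fits]. Obeying it moves
    the [2 ^ lev l] jobs of the bundle from [rest] to [X], and their processing time from the
    capacity to the load. *)
Lemma partial_place C l u X (i := (dp C l.+1 u).-1) :
  pos l < nslots -> active l -> partial C l.+1 u X ->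
  [/\ i < m, psize (typ l) <= dig base i u &
      partial C l (u - psize (typ l) * base ^ i)
        (update X (typ l * m + i) (X (typ l * m + i) + 2 ^ lev l))].
Proof.
move=> lt_p act [H1 H2 H3 H4 H5]; set T := typ l.
have lt_T : T < ntypes by exact: typ_lt.
have Edp : dp C l.+1 u = pick_below (fits (dp C l) l u) m.
  by rewrite /= /dp_step lt_p act.
have i_gt0 : 0 < pick_below (fits (dp C l) l u) m by rewrite -Edp.
have lt_i : i < m.
  by rewrite /i Edp prednK //; exact: pick_below_le.
have := pick_belowP i_gt0; rewrite -Edp -/i => /and3P[fl le_p dp_gt0].
have Xnew T' i' : i' < m -> update X (T * m + i) (X (T * m + i) + 2 ^ lev l) (T' * m + i') =
    X (T' * m + i') + ((T' == T) && (i == i')) * 2 ^ lev l.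
  move=> lt_i'; rewrite /update slot_inj // [i' == i]eq_sym.
  by case: andP => [[/eqP -> /eqP ->] | _]; rewrite ?addn0 ?mul1n.
split=> //; split=> // [|i' lt_i'|T' lt_T'|T' i' lt_T' lt_i'].
- by apply: leq_ltn_trans H2; exact: leq_subr.
- under eq_bigr => T' _ do rewrite Xnew // mulnDr.
  rewrite big_split /= -addnA; apply: leq_trans (H3 i' lt_i').
  rewrite leq_add2l capacity_S // -(capacity_sub C l i' le_p) addnC leq_add2l.
  rewrite (bigD1 (Ordinal lt_T)) //= eqxx [X in _ + X]big1 ?addn0; last first.
    by move=> T' /negPf; rewrite -val_eqE /= => ->; rewrite muln0.
  by rewrite mulnCA [psize _ * _]mulnC.
- under eq_bigr => i' _ do rewrite Xnew //.
  rewrite big_split /= -addnA -(H4 T' lt_T'); congr (_ + _).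
  rewrite rest_S addnC lt_p act /= -/T [T == T']eq_sym; congr (_ + _).
  rewrite (bigD1 (Ordinal lt_i)) //= eqxx andbT [X in _ + X]big1 ?addn0 //.
  by move=> i' /negPf; rewrite -val_eqE /= eq_sym => ->; rewrite andbF.
rewrite Xnew //; case: andP => [[/eqP -> /eqP <-] // | _]; rewrite addn0; exact: H5.
Qed.

(** The bundling of the distribution [x] tells the machine of every bundle. If the bundles are
    placed accordingly, the load still to come never exceeds the remaining capacities, and
    truncating these to [cap_max] units does no harm since that load is never larger. *)
Lemma dp_complete C (x : nat -> nat -> nat) :
  (forall T, T < ntypes -> \sum_(i < m) x T i = Nc T) ->
  (forall T i, T < ntypes -> i < m -> 0 < x T i -> 0 < flag T i) ->
  (forall i, i < m -> \sum_(T < ntypes) psize T * x T i <= C) ->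
  0 < dp C (K * nlayers) (dp_start C).
Proof.
move=> sum_x flag_x load_x.
have [a Ha] : exists a : 'I_ntypes -> nat -> nat -> 'I_m, forall (T : 'I_ntypes) (i : 'I_m),
    x T i = \sum_(j < K) 2 ^ j *
      \sum_(s < halves m (Nc T) j - 2 * halves m (Nc T) j.+1) (a T j s == i).
  apply: (@fin_all_exists 'I_ntypes (fun=> nat -> nat -> 'I_m) (fun T aT => forall i : 'I_m,
    x T i = \sum_(j < K) 2 ^ j *
      \sum_(s < halves m (Nc T) j - 2 * halves m (Nc T) j.+1) (aT j s == i))) => T.
  apply: exists_bundling => //; first exact: sum_x.
  by rewrite halves_eq0 ?Nc_lt.
(* In a layer that passes to the next level, [typ l] is out of range; [T0] makes [al] total. *)
pose T0 := Ordinal ntypes_gt0.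
pose al l : 'I_m := a (insubd T0 (typ l)) (lev l) (pos l %% m).
pose load l i := ([&& pos l < nslots, active l & al l == i :> nat] * (2 ^ lev l * psize (typ l))).
pose need l i := \sum_(l' < l) load l' i.
have al_flag l : pos l < nslots -> active l -> l < K * nlayers -> 0 < flag (typ l) (al l).
  move=> lt_p act lt_l; have lt_T := typ_lt lt_p.
  apply: flag_x => //; rewrite -[typ l]/(val (Ordinal lt_T)) Ha.
  have lt_k : lev l < K by rewrite /lev ltn_divLR.
  rewrite (bigD1 (Ordinal lt_k)) //= ltn_addr // muln_gt0 expn_gt0 /=.
  have lt_s : pos l %% m < halves m (Nc (typ l)) (lev l) - 2 * halves m (Nc (typ l)) (lev l).+1.
    by move: act; rewrite /active; lia.
  rewrite (bigD1 (Ordinal lt_s)) //= ltn_addr // /al.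
  suff -> : insubd T0 (typ l) = Ordinal lt_T by rewrite eqxx.
  by apply: val_inj; rewrite val_insubd lt_T.
have need_all i : i < m -> need (K * nlayers) i = \sum_(T < ntypes) psize T * x T i.
  move=> lt_i; rewrite /need (sum_layers (F := load^~ i)); last first.
    by move=> l; rewrite /load; case: (pos l < nslots).
  rewrite exchange_big /=; apply: eq_bigr => T _.
  rewrite (Ha T (Ordinal lt_i)) big_distrr /=; apply: eq_bigr => k _.
  rewrite -(sum_ord_lt (fun s => a T k s == Ordinal lt_i) (slots_le T k)).
  rewrite !big_distrr /=; apply: eq_bigr => s _.
  rewrite /load active_block // typ_block // pos_slot // lev_slot //=.
  rewrite /al typ_block // pos_slot // lev_slot // modnMDl modn_small //.
  have -> : insubd T0 (T : nat) = T by apply: val_inj; rewrite val_insubd ltn_ord.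
  rewrite slot_lt // -val_eqE /=; move: (_ < _) (_ == _ :> nat) => b1 b2.
  by rewrite [RHS]mulnA [RHS]mulnC [psize T * _]mulnC mulnb.
have need_bound l i : need l i <= 2 ^ lev l * cap_max.
  apply: leq_trans (_ : (\sum_(l' < l) (pos l' < nslots) * 2 ^ lev l') * Q <= _).
    rewrite big_distrl /=; apply: leq_sum => l' _; rewrite /load -mulnA.
    case: (pos l' < nslots) => //=; rewrite mul1n.
    apply: leq_trans (_ : 1 * (2 ^ lev l' * psize (typ l')) <= _).
      by rewrite leq_mul2r leq_b1 orbT.
    rewrite mul1n.
    by rewrite leq_mul2l ltnW ?orbT // ltn_pmod.
  have := sum_slots l; have := pos_le l.
  rewrite /cap_max mulnA leq_mul2r => H1 H2; apply/orP; right.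
  by move: H1 H2; have := expn_gt0 2 (lev l); move: (2 ^ _) (pos l) (\sum_(_ < _) _) => e q v; nia.
(* Generalized to all layers and states: it suffices that each machine has room for the bundles of
   the layers below. *)
suff H l u : l <= K * nlayers -> (forall i, i < m -> need l i <= capacity C l u i) -> 0 < dp C l u.
  apply: H => // i lt_i; rewrite need_all //.
  have := need_bound (K * nlayers) i; rewrite need_all //.
  rewrite /capacity /lev mulnK // dig_start //.
  have := load_x i lt_i; rewrite {1}(divn_eq C (2 ^ K)) [_ * 2 ^ K]mulnC.
  by rewrite /minn; case: ifP => _ H1 H2 //; apply: leq_trans H2 _; exact: leq_addr.
elim: l u => [|l IH] u lt_l // Hcap.
rewrite [dp _ _ _]/= /dp_step; case: ifP => [lt_p | /negbT le_p]; last first.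
  (* Either the new digit is truncated to [cap_max], and [need_bound] suffices, or the capacity is
     unchanged. *)
  apply: IH (ltnW lt_l) _ => i lt_i; rewrite /capacity dig_refine //.
  have := Hcap i lt_i; have := need_bound l i; rewrite capacity_refined //.
  rewrite {2}/need big_ord_recr /= -/(need l i) => H1 H2.
  have {}H2 := leq_trans (leq_addr _ _) H2.
  by rewrite /minn; case: ifP => _ //; apply: leq_trans H1 _; exact: leq_addr.
have needS i : need l.+1 i = need l i + load l i by rewrite /need big_ord_recr.
case: ifP => [act | inact]; last first.
  apply: IH (ltnW lt_l) _ => i lt_i; rewrite -capacity_S // -[need _ _]addn0.
  by have := Hcap i lt_i; rewrite needS /load inact andbF.
(* The residue of [C] is less than one unit of [2 ^ lev l], and the bundle takes whole units, so it
   must fit into the digit. *)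
set i := al l; have le_d : psize (typ l) <= dig base i u.
  have := Hcap i (ltn_ord i); rewrite needS /load lt_p act eqxx /= mul1n capacity_S //.
  rewrite /capacity; have := ltn_pmod C (_ : 0 < 2 ^ lev l).
  rewrite expn_gt0 => /(_ isT); move: (2 ^ _) (C %% _) (need _ _) => e c q; nia.
apply: (pick_below_gt0 (i := i)) => //; rewrite /fits al_flag // le_d /=.
apply: IH (ltnW lt_l) _ => i' lt_i'.
rewrite -(leq_add2r ((i == i' :> nat) * (2 ^ lev l * psize (typ l)))) capacity_sub //.
by have := Hcap i' lt_i'; rewrite needS capacity_S // /load lt_p act.
Qed.

End DynamicProgram.

(** * Job types of an instance, read from the input words *)

Lemma nth_flatten_const (T : Type) (x : T) (ss : seq (seq T)) d j r :
  all (fun s => size s == d) ss -> r < d ->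
  nth x (flatten ss) (j * d + r) = nth x (nth [::] ss j) r.
Proof.
move=> + lt_r; elim: ss j => [|s ss IH] [|j] //=; rewrite ?nth_nil //.
  by case/andP=> /eqP size_s _; rewrite nth_cat size_s mul0n add0n lt_r.
case/andP=> /eqP size_s Hss; rewrite nth_cat size_s mulSn -addnA.
by rewrite ltnNge leq_addr /= addKn IH.
Qed.

Section Instance.

Variables (m n : nat) (I : instance m n).

Definition word (a : nat) : nat := nth 0 (input_words I) a.
Definition nsizes : nat := (pmax I).+1.
Definition first_word (j : nat) : nat := (j * m.+1).+1.

Definition job_type (j : nat) : nat :=
  word (first_word j) + nsizes * \sum_(i < m) word (first_word j + i.+1) * 2 ^ i.

Definition type_count (T : nat) : nat := \sum_(j < n) (job_type j == T).

Let record (j : 'I_n) : seq nat :=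
  p I j :: [seq nat_of_bool (isSome (ptime I i j)) | i <- enum 'I_m].

Lemma size_records : all (fun s => size s == m.+1) [seq record j | j <- enum 'I_n].
Proof. by apply/allP => s /mapP[j _ ->]; rewrite /= size_map size_enum_ord. Qed.

Lemma word_record (j : 'I_n) r : r < m.+1 ->
  word (first_word j + r) = nth 0 (record j) r.
Proof.
move=> lt_r; rewrite /word /first_word addSn /= nth_flatten_const ?size_records //.
by rewrite (nth_map j) ?size_enum_ord // nth_ord_enum.
Qed.

Lemma word_size (j : 'I_n) : word (first_word j) = p I j.
Proof. by rewrite -[first_word j]addn0 word_record. Qed.

Lemma word_flag (j : 'I_n) (i : 'I_m) :
  word (first_word j + i.+1) = isSome (ptime I i j).
Proof.
by rewrite word_record ?ltnS //= (nth_map i) ?size_enum_ord // nth_ord_enum.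
Qed.

Lemma size_input : size (input_words I) = (n * m.+1).+1.
Proof.
rewrite /= size_flatten /shape -map_comp (@eq_map _ _ _ (fun=> m.+1)).
  by rewrite sumnE big_map big_enum sum_nat_const card_ord.
by move=> j /=; rewrite size_map size_enum_ord.
Qed.

Lemma word_out a : n * m.+1 < a -> word a = 0.
Proof. by move=> lt_a; rewrite /word nth_default // size_input. Qed.

Lemma word_bound a : word a <= n + nsizes.
Proof.
have [lt_a | /word_out -> //] := leqP a (n * m.+1).
case: a lt_a => [|a] lt_a; first exact: leq_addr.
have lt_j : a %/ m.+1 < n by rewrite ltn_divLR.
rewrite {1}(divn_eq a m.+1) -addSn -/(first_word _).
rewrite (word_record (Ordinal lt_j)) ?ltn_pmod //.
apply: leq_trans (leq_addl _ _); case: (a %% m.+1) => [|i] /=.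
  by apply: leqW; exact: (leq_bigmax (Ordinal lt_j)).
have [lt_i | le_i] := ltnP i m.
  by rewrite (nth_map (Ordinal lt_i)) ?size_enum_ord //; apply: leq_trans (leq_b1 _) _.
by rewrite nth_default // size_map size_enum_ord.
Qed.

Lemma size_lt (j : 'I_n) : p I j < nsizes.
Proof. by rewrite ltnS; exact: leq_bigmax. Qed.

Lemma mask_lt (j : 'I_n) : \sum_(i < m) word (first_word j + i.+1) * 2 ^ i < 2 ^ m.
Proof.
apply: (sum_digits_lt (v := fun i => word (first_word j + i.+1))) => i lt_i.
by rewrite (word_flag j (Ordinal lt_i)) ltnS leq_b1.
Qed.

Lemma job_type_lt (j : 'I_n) : job_type j < ntypes m nsizes.
Proof. by rewrite /job_type /ntypes word_size; have := size_lt j; have := mask_lt j; nia. Qed.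

Lemma psize_job (j : 'I_n) : psize nsizes (job_type j) = p I j.
Proof. by rewrite /psize /job_type addnC mulnC modnMDl word_size modn_small ?size_lt. Qed.

Lemma flag_job (j : 'I_n) (i : 'I_m) :
  flag nsizes (job_type j) i = isSome (ptime I i j).
Proof.
have -> : flag nsizes (job_type j) i =
    dig 2 i (\sum_(i < m) word (first_word j + i.+1) * 2 ^ i).
  rewrite /flag /job_type addnC mulnC divnMDl // word_size.
  by rewrite [p I j %/ _]divn_small ?size_lt // addn0.
rewrite -word_flag; apply: (dig_sum (v := fun i => word (first_word j + i.+1))) => // i' lt_i.
by rewrite (word_flag j (Ordinal lt_i)) ltnS leq_b1.
Qed.

Lemma type_count_le T : type_count T <= n.
Proof.
by rewrite -[X in _ <= X]card_ord -sum1_card; apply: leq_sum => j _; exact: leq_b1.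
Qed.

Lemma sum_by_type (F : nat -> nat) (A : 'I_n -> bool) :
  \sum_(T < ntypes m nsizes) F T * \sum_(j < n) ((job_type j == T) && A j) =
  \sum_(j < n | A j) F (job_type j).
Proof.
rewrite [RHS]big_mkcond /=; under eq_bigr => T _ do rewrite big_distrr /=.
rewrite exchange_big /=; apply: eq_bigr => j _.
rewrite (bigD1 (Ordinal (job_type_lt j))) //= eqxx big1 ?addn0.
  by case: (A j); rewrite ?muln1 ?muln0.
by move=> T /negPf; rewrite -val_eqE /= eq_sym => ->; rewrite muln0.
Qed.

Lemma load_schedule sigma i : is_schedule I sigma ->
  \sum_(j < n | sigma j == i) odflt 0 (ptime I i j) = \sum_(j < n | sigma j == i) p I j.
Proof.
move=> H; apply: eq_bigr => j /eqP E; have := H j; rewrite E.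
by case: (ptimeP I i j) => ->.
Qed.

Lemma makespan_ub sigma : is_schedule I sigma -> makespan I sigma <= n * nsizes.
Proof.
move=> H; apply/bigmax_leqP => i _; rewrite load_schedule //.
apply: leq_trans (_ : \sum_(j < n) nsizes <= _); last by rewrite sum_nat_const card_ord.
by rewrite big_mkcond /=; apply: leq_sum => j _; case: ifP => // _; exact: ltnW (size_lt j).
Qed.

Lemma dp_of_schedule K C sigma : 0 < m -> n < 2 ^ K ->
  is_schedule I sigma -> makespan I sigma <= C ->
  0 < dp m nsizes type_count C (K * nlayers m nsizes) (dp_start m nsizes K C).
Proof.
move=> m0 ltK sched le_C.
pose x T i := \sum_(j < n) ((job_type j == T) && (sigma j == i :> nat)).
apply: (dp_complete m0 _ _ (x := x)) => //.
- by move=> T _; apply: leq_ltn_trans ltK; exact: type_count_le.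
- move=> T _; rewrite /x exchange_big /=; apply: eq_bigr => j _.
  rewrite (bigD1 (sigma j)) //= eqxx andbT big1 ?addn0 // => i /negPf.
  by rewrite eq_sym -val_eqE /= => ->; rewrite andbF.
- move=> T i _ lt_i; rewrite lt0n sum_nat_eq0 => /forallPn[j] /=.
  rewrite eqb0 negbK => /andP[/eqP <- /eqP <-]; rewrite flag_job.
  by have := sched j; case: ptime.
move=> i lt_i; rewrite sum_by_type; apply: leq_trans le_C.
apply: leq_trans (leq_bigmax (Ordinal lt_i)); rewrite load_schedule //.
by under eq_bigr => j _ do rewrite psize_job.
Qed.

(** The type of a job determines its processing time and its machines, so any schedule with the
    prescribed numbers of jobs per type and machine will do. *)
Lemma schedule_of_counts C (X : nat -> nat) (sigma : 'I_n -> 'I_m) :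
  (forall T i, T < ntypes m nsizes -> i < m ->
     \sum_(j < n) ((job_type j == T) && (sigma j == i :> nat)) = X (T * m + i)) ->
  (forall i, i < m -> \sum_(T < ntypes m nsizes) psize nsizes T * X (T * m + i) <= C) ->
  (forall T i, T < ntypes m nsizes -> i < m -> 0 < X (T * m + i) -> 0 < flag nsizes T i) ->
  is_schedule I sigma /\ makespan I sigma <= C.
Proof.
move=> HX Hload Hflag; have sched : is_schedule I sigma.
  move=> j; have := Hflag _ _ (job_type_lt j) (ltn_ord (sigma j)).
  rewrite flag_job -HX ?job_type_lt // (bigD1 j) //= !eqxx /= => /(_ isT).
  by case: ptime.
split=> //; apply/bigmax_leqP => i _; rewrite load_schedule //.
apply: leq_trans (Hload i (ltn_ord i)).
under eq_bigr => j _ do rewrite -psize_job.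
rewrite -(sum_by_type (psize nsizes)) leq_sum // => T _.
by rewrite -HX.
Qed.

End Instance.

(** * The program *)

Section Expressions.

Variable m : nat.

Definition rn := 0.
Definition rQ := 1.
Definition rK := 2.
Definition rj := 3.
Definition rlo := 4.
Definition rhi := 5.
Definition rC := 6.
Definition ru := 7.
Definition rT := 8.
Definition rc := 9.

Local Open Scope expr_scope.

Definition e_types : expr := Const (2 ^ m)%N * Reg rQ.
Definition e_slots : expr := e_types * Const m.
Definition e_layers : expr := e_slots + Const 1.
Definition e_cap : expr := Const 2 * e_slots * Reg rQ.
Definition e_base : expr := e_cap + Const 1.
Definition e_states : expr := epow e_base m.

Definition e_pows : expr := Reg rn * Const m.+1 + Const 1.
Definition e_halves : expr := e_pows + Reg rK + Const 1.
Definition e_counts : expr := e_halves + (Reg rK + Const 1) * e_types.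
Definition e_dp : expr := e_counts + e_slots.

Definition e_first (j : expr) : expr := j * Const m.+1 + Const 1.
Definition e_job_type (j : expr) : expr :=
  Read (e_first j)
  + Reg rQ * esum (fun i => Read (e_first j + Const i.+1) * Const (2 ^ i)%N) m.

Definition e_lev (l : expr) : expr := l %/ e_layers.
Definition e_pos (l : expr) : expr := l %% e_layers.
Definition e_typ (l : expr) : expr := e_pos l %/ Const m.
Definition e_psize (l : expr) : expr := e_typ l %% Reg rQ.
Definition e_read_half (k T : expr) : expr := Read (e_halves + (k * e_types + T)).
Definition e_active (l : expr) : expr :=
  (e_pos l %% Const m + Const 2 * e_read_half (e_lev l + Const 1) (e_typ l)
   < e_read_half (e_lev l) (e_typ l)).
Definition e_dig (i : nat) (u : expr) : expr := u %/ epow e_base i %% e_base.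
Definition e_pow (l : expr) : expr := Read (e_pows + e_lev l).
Definition e_min (a b : expr) : expr := cond (a < b) a b.
Definition e_refine (l u : expr) : expr :=
  esum (fun i => e_min e_cap (Const 2 * e_dig i u + Reg rC %/ e_pow l %% Const 2)
                 * epow e_base i) m.
Definition e_read_dp (l u : expr) : expr := Read (e_dp + (l * e_states + u)).
Definition e_fits (l u : expr) (i : nat) : expr :=
  (Const 0 < e_typ l %/ Reg rQ %/ Const (2 ^ i)%N %% Const 2)
  * (e_psize l <= e_dig i u)
  * (Const 0 < e_read_dp l (u - e_psize l * epow e_base i)).
Definition e_step (l u : expr) : expr :=
  cond (e_pos l < e_slots)
    (cond (e_active l) (epick (e_fits l u) m) (e_read_dp l u))
    (e_read_dp l (e_refine l u)).
Definition e_start : expr :=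
  esum (fun i => e_min e_cap (Reg rC %/ Read (e_pows + Reg rK)) * epow e_base i) m.
Definition e_feasible : expr := e_read_dp (Reg rK * e_layers) e_start.

End Expressions.

(** * Memory layout and values of the expressions *)

Section Evaluation.

Variables (m n : nat) (I : instance m n).

Local Notation K := (bits n).
Local Notation Q := (nsizes I).
Local Notation NT := (ntypes m Q).
Local Notation NS := (nslots m Q).
Local Notation V := (nstates m Q).
Local Notation Nc := (type_count I).

(* The memory consists of the input, the powers of two (from [adP]), the numbers
   [halves m (Nc T) k] (from [adN]), the numbers of jobs of each type on each
   machine (from [adX]), and the table of the dynamic program (from [adG]). *)
Definition adP : nat := n * m.+1 + 1.
Definition adN : nat := adP + K + 1.
Lemma adP_lt_adN : adP < adN.
Proof. by rewrite /adN addn1 ltnS leq_addr. Qed.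

Definition adX : nat := adN + (K + 1) * NT.
Definition adG : nat := adX + NS.

Record params (s : state) : Prop := Params {
  param_n : reg s rn = n;
  param_Q : reg s rQ = Q;
  param_K : reg s rK = K }.

Record statics (M : nat -> nat) : Prop := Statics {
  static_input : forall a, a < adP -> M a = word I a;
  static_pow : forall k, k <= K -> M (adP + k) = 2 ^ k;
  static_half : forall k T, k <= K -> T < NT -> M (adN + (k * NT + T)) = halves m (Nc T) k }.

(** What every filling of the table starts from. Filling begins with layer 1, so these facts survive
    all rounds of the search; rebuilding the schedule then changes the counts, and only [statics]
    persists. *)
Record tables (M : nat -> nat) : Prop := Tables {
  table_static : statics M;
  table_count : forall a, a < NS -> M (adX + a) = 0;
  table_layer0 : forall u, u < V -> M (adG + u) = 1 }.

Definition dp_cells (C A : nat) (M : nat -> nat) : Prop :=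
  forall a, a < A -> M (adG + a) = dp m Q Nc C (a %/ V) (a %% V).

Lemma eval_types s : params s -> eval s (e_types m) = NT.
Proof. by case=> _ H _; rewrite !evalE H. Qed.

Lemma eval_slots s : params s -> eval s (e_slots m) = NS.
Proof. by move=> H; rewrite eval_mul eval_types. Qed.

Lemma eval_layers s : params s -> eval s (e_layers m) = nlayers m Q.
Proof. by move=> H; rewrite eval_add eval_slots // addn1. Qed.

Lemma eval_cap s : params s -> eval s (e_cap m) = cap_max m Q.
Proof. by move=> H; rewrite 2!eval_mul eval_slots // eval_reg param_Q. Qed.

Lemma eval_base s : params s -> eval s (e_base m) = base m Q.
Proof. by move=> H; rewrite eval_add eval_cap // addn1. Qed.

Lemma eval_states s : params s -> eval s (e_states m) = V.
Proof. by move=> H; rewrite eval_pow eval_base. Qed.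

Lemma eval_pows s : reg s rn = n -> eval s (e_pows m) = adP.
Proof. by move=> H; rewrite !evalE H. Qed.

Lemma eval_halves s : params s -> eval s (e_halves m) = adN.
Proof. by move=> H; rewrite 2!eval_add eval_pows ?param_n // eval_reg param_K. Qed.

Lemma eval_counts s : params s -> eval s (e_counts m) = adX.
Proof.
by move=> H; rewrite eval_add eval_halves // eval_mul eval_types // eval_add eval_reg param_K.
Qed.

Lemma eval_dp s : params s -> eval s (e_dp m) = adG.
Proof. by move=> H; rewrite eval_add eval_counts // eval_slots. Qed.

Lemma eval_first s e : eval s (e_first m e) = first_word m (eval s e).
Proof. by rewrite !evalE /first_word addn1. Qed.

(** Only cells beyond [j] have to be intact: the output phase has by then overwritten the cells up
    to [j], and the record of job [j] starts later. *)
Lemma eval_job_type s e j :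
  params s -> eval s e = j -> j < n ->
  (forall a, j < a < adP -> mem s a = word I a) ->
  eval s (e_job_type m e) = job_type I j.
Proof.
move=> Hp Ee lt_j HM; rewrite /job_type eval_add eval_read eval_mul eval_sum eval_reg.
rewrite param_Q // eval_first Ee.
have lt_f : first_word m j + m < adP by rewrite /first_word /adP; nia.
have gt_f : j < first_word m j by rewrite /first_word; nia.
rewrite HM; last by rewrite gt_f; apply: leq_trans lt_f; rewrite ltnS leq_addr.
congr (_ + _ * _); apply: eq_bigr => i _.
rewrite eval_mul eval_read eval_add eval_first !eval_const Ee HM //.
by have := ltn_ord i; lia.
Qed.

Lemma eval_lev s e : params s -> eval s (e_lev m e) = lev m Q (eval s e).
Proof. by move=> H; rewrite (eval_div, eval_mod) eval_layers. Qed.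

Lemma eval_pos s e : params s -> eval s (e_pos m e) = pos m Q (eval s e).
Proof. by move=> H; rewrite (eval_div, eval_mod) eval_layers. Qed.

Lemma eval_typ s e : params s -> eval s (e_typ m e) = typ m Q (eval s e).
Proof. by move=> H; rewrite eval_div eval_pos. Qed.

Lemma eval_psize s e : params s -> eval s (e_psize m e) = psize Q (typ m Q (eval s e)).
Proof. by move=> H; rewrite eval_mod eval_typ // eval_reg param_Q. Qed.

Lemma eval_dig s i e : params s -> eval s (e_dig m i e) = dig (base m Q) i (eval s e).
Proof. by move=> H; rewrite eval_mod eval_div eval_pow eval_base. Qed.

Hypotheses (m_gt0 : 0 < m).

Lemma lev_lt l : l < K * nlayers m Q -> lev m Q l < K.
Proof. by rewrite /lev ltn_divLR. Qed.

Lemma eval_read_half s ek eT k T : params s -> statics (mem s) ->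
  eval s ek = k -> eval s eT = T -> k <= K -> T < NT ->
  eval s (e_read_half m ek eT) = halves m (Nc T) k.
Proof.
move=> Hp Ht Ek ET le_k lt_T.
by rewrite eval_read eval_add eval_halves // eval_add eval_mul eval_types // Ek ET static_half.
Qed.

Lemma eval_active s e l : params s -> statics (mem s) ->
  eval s e = l -> l < K * nlayers m Q -> pos m Q l < NS ->
  eval s (e_active m e) = active m Q Nc l.
Proof.
move=> Hp Ht Ee lt_l lt_p; have lt_T := typ_lt m_gt0 lt_p; have lt_k := lev_lt lt_l.
have Ek : eval s (e_lev m e) = lev m Q l by rewrite eval_lev ?Ee.
have Ek1 : eval s (e_lev m e + Const 1)%X = (lev m Q l).+1 by rewrite eval_add Ek addn1.
have ET : eval s (e_typ m e) = typ m Q l by rewrite eval_typ ?Ee.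
rewrite eval_ltn eval_add eval_mod eval_pos // eval_mul Ee.
by rewrite (eval_read_half Hp Ht Ek1 ET) // (eval_read_half Hp Ht Ek ET) // ltnW.
Qed.

Lemma eval_min s e1 e2 : eval s (e_min e1 e2) = minn (eval s e1) (eval s e2).
Proof. by rewrite eval_cond eval_ltn lt0b; case: ltnP. Qed.

Lemma eval_pow_lev s e : params s -> statics (mem s) -> lev m Q (eval s e) < K ->
  eval s (e_pow m e) = 2 ^ lev m Q (eval s e).
Proof.
move=> Hp Ht lt_k.
by rewrite eval_read eval_add eval_pows ?param_n // eval_lev // static_pow // ltnW.
Qed.

Lemma eval_refine s el eu C : params s -> statics (mem s) -> reg s rC = C ->
  eval s el < K * nlayers m Q ->
  eval s (e_refine m el eu) = refine m Q C (eval s el) (eval s eu).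
Proof.
move=> Hp Ht EC lt_l; rewrite eval_sum; apply: eq_bigr => i _.
rewrite eval_mul eval_min eval_pow eval_base // eval_cap //.
by rewrite eval_add eval_mul eval_dig // eval_mod eval_div eval_pow_lev ?lev_lt // eval_reg EC.
Qed.

Lemma eval_read_dp s el eu l u : params s -> eval s el = l -> eval s eu = u ->
  eval s (e_read_dp m el eu) = mem s (adG + (l * V + u)).
Proof.
move=> Hp El Eu.
by rewrite eval_read eval_add eval_dp // eval_add eval_mul eval_states // El Eu.
Qed.

Lemma V_gt0 : 0 < V. Proof. exact: base_exp_gt0. Qed.

Lemma dp_cellsE C A M l u : dp_cells C A M -> l * V + u < A -> u < V ->
  M (adG + (l * V + u)) = dp m Q Nc C l u.
Proof.
by move=> H lt_A lt_u; rewrite H // divnMDl ?V_gt0 // modnMDl divn_small // addn0 modn_small.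
Qed.

Lemma eval_step s el eu l u C : params s -> statics (mem s) -> reg s rC = C ->
  eval s el = l -> eval s eu = u -> l < K * nlayers m Q -> u < V ->
  dp_cells C (l.+1 * V) (mem s) ->
  eval s (e_step m el eu) = dp m Q Nc C l.+1 u.
Proof.
move=> Hp Ht EC El Eu lt_l lt_u Hdp.
have rd e v : eval s e = v -> v < V -> eval s (e_read_dp m el e) = dp m Q Nc C l v.
  move=> Ev lt_v; rewrite (eval_read_dp Hp El Ev) (dp_cellsE Hdp) //.
  by rewrite mulSn addnC ltn_add2r.
rewrite [dp _ _ _ _ _ _]/= /dp_step eval_cond eval_ltn eval_pos // eval_slots // El.
rewrite lt0b -/NS; case: ifP => lt_p; last first.
  by apply: rd; [rewrite (eval_refine _ Hp Ht EC) ?El ?Eu | exact: refine_lt].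
rewrite eval_cond (eval_active Hp Ht El) // lt0b; case: ifP => act; last exact: rd.
rewrite eval_pick; apply: eq_pick_below => i _.
rewrite /fits !eval_mul !muln_gt0 !eval_ltn eval_leq !lt0b eval_const -andbA.
rewrite eval_mod 2!eval_div eval_typ // eval_psize // eval_dig // eval_reg param_Q // El Eu.
congr [&& _, _ & 0 < _].
rewrite (rd _ (u - psize Q (typ m Q l) * base m Q ^ i)) //.
  by rewrite eval_sub eval_mul eval_psize // eval_pow eval_base // El Eu.
by apply: leq_ltn_trans lt_u; exact: leq_subr.
Qed.

Lemma eval_start s C : params s -> statics (mem s) -> reg s rC = C ->
  eval s (e_start m) = dp_start m Q K C.
Proof.
move=> Hp Ht EC; rewrite eval_sum; apply: eq_bigr => i _.
rewrite eval_mul eval_min eval_pow eval_base // eval_cap //.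
by rewrite eval_div eval_read eval_add eval_pows ?param_n // !eval_reg param_K // static_pow // EC.
Qed.

Lemma eval_feasible s C : params s -> statics (mem s) -> reg s rC = C ->
  dp_cells C ((K * nlayers m Q).+1 * V) (mem s) ->
  eval s (e_feasible m) = dp m Q Nc C (K * nlayers m Q) (dp_start m Q K C).
Proof.
move=> Hp Ht EC Hdp; rewrite (eval_read_dp Hp _ (eval_start Hp Ht EC) (l := K * nlayers m Q)).
  by rewrite (dp_cellsE Hdp) ?dp_start_lt // mulSn addnC ltn_add2r dp_start_lt.
by rewrite eval_mul eval_layers // eval_reg param_K.
Qed.

End Evaluation.

(** * Counting loops *)

Lemma update_same f a v : update f a v a = v.
Proof. by rewrite /update eqxx. Qed.

Lemma update_other f a v x : x != a -> update f a v x = f x.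
Proof. by rewrite /update => /negPf ->. Qed.

Lemma run_seq c1 c2 s : run (Seq c1 c2) s = run c2 (run c1 s). Proof. by []. Qed.
Lemma run_assign x e s :
  run (Assign x e) s = State (update (reg s) x (eval s e)) (mem s).
Proof. by []. Qed.
Lemma run_store a e s :
  run (Store a e) s = State (reg s) (update (mem s) (eval s a) (eval s e)).
Proof. by []. Qed.
Lemma run_if e c1 c2 s :
  run (If e c1 c2) s = if eval s e != 0 then run c1 s else run c2 s.
Proof. by []. Qed.
Definition runE := (run_seq, run_assign, run_store).

Definition below (B : nat) (f : nat -> nat) : Prop := forall x, f x < B.

Lemma below_update B f a v : below B f -> v < B -> below B (update f a v).
Proof. by move=> Hf Hv x; rewrite /update; case: eqP. Qed.

Definition incr (x : nat) : cmd := Assign x (Reg x + Const 1)%X.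

Definition count_loop (lim : expr) (body : cmd) : cmd :=
  Seq (Assign rj (Const 0)) (While (Reg rj < lim)%X (Seq body (incr rj))).

Definition kloop (lim : expr) (body : cmd) : nat :=
  kcmd (Assign rj (Const 0)) + kcmd (Seq body (incr rj)) + kexpr (Reg rj < lim)%X.

(** The bound that [runs_loop_free] gives for the final state grows with each execution, so it
    cannot be iterated. Instead the body must be shown to respect the same [b] again, by means of
    the invariant; then every iteration takes time O(b). *)
Lemma runs_count b lim body A (P : nat -> state -> Prop) s :
  0 < b -> loop_free body -> A < 2 ^ b -> bounded b s ->
  P 0 (State (update (reg s) rj 0) (mem s)) ->
  (forall i s, i <= A -> P i s -> reg s rj = i -> eval s lim = A) ->
  (forall i s, i < A -> P i s -> reg s rj = i -> bounded b s ->
     [/\ reg (run body s) rj = i, bounded b (run body s) &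
         P i.+1 (State (update (reg (run body s)) rj i.+1) (mem (run body s)))]) ->
  exists s', [/\ runs (count_loop lim body) s (kloop lim body * A.+1 * b) s',
                 P A s' & bounded b s'].
Proof.
move=> b0 lf ltA Hs P0 Hlim Hstep.
pose P' i s := [/\ P i s, reg s rj = i & bounded b s].
have P'0 : P' 0 (State (update (reg s) rj 0) (mem s)).
  split=> //; split=> [|a] /=; last by case: Hs.
  by apply: below_update; [case: Hs | rewrite expn_gt0].
have P'lim i s1 : i <= A -> P' i s1 -> (eval s1 (Reg rj < lim)%X != 0) = (i < A).
  by move=> le_i [Pi Ri _]; rewrite eval_ltn eval_reg Ri (Hlim i) // eqb0 negbK.
have P'step i s1 : i < A -> P' i s1 ->
    exists2 s2, runs (Seq body (incr rj)) s1 (kcmd (Seq body (incr rj)) * b) s2 & P' i.+1 s2.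
  move=> lt_i [Pi Ri Bi]; exists (run (Seq body (incr rj)) s1).
    by apply: runs_run => //=; rewrite lf.
  have [R1 [B1r B1m] P1] := Hstep _ _ lt_i Pi Ri Bi.
  rewrite /= !evalE R1 addn1; split=> //=; split=> //=.
  by apply: below_update => //; apply: leq_ltn_trans ltA.
have P'b i s1 : P' i s1 -> bounded b s1 by case.
have [s' R [PA _ BA]] := runs_for b0 P'b P'lim P'step P'0.
exists s'; split=> //.
have R0 : runs (Assign rj (Const 0)) s (kcmd (Assign rj (Const 0)) * b)
    (State (update (reg s) rj 0) (mem s)).
  exact: runs_run.
apply: runs_le (runs_seq R0 R); rewrite -mulnDl leq_mul2r /kloop; apply/orP; right.
by move: (kcmd _) (kcmd _) (kexpr _) => x y z; nia.
Qed.

(** * Preprocessing: sizes, powers of two, numbers of jobs and bundles, layer 0 *)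

Section Programs.

Variable m : nat.

Local Open Scope expr_scope.

Definition size_body : cmd :=
  let w := Read (e_first m (Reg rj)) in
  Assign rQ (cond (Reg rQ <= w) (w + Const 1) (Reg rQ)).

Definition pow_body : cmd :=
  Seq (Store (e_pows m + Reg rK + Const 1) (Const 2 * Read (e_pows m + Reg rK)))
      (incr rK).

Definition count_body : cmd :=
  let a := e_halves m + e_job_type m (Reg rj) in Store a (Read a + Const 1).

(** One flat loop runs over all levels and types: rows have length [e_types m], so the cell one row
    further holds the next halving for the same type. *)
Definition halve_body : cmd :=
  Store (e_halves m + e_types m + Reg rj)
        ((Read (e_halves m + Reg rj) - Const m + Const 1) %/ Const 2).

Definition layer0_body : cmd := Store (e_dp m + Reg rj) (Const 1).

Definition prog_sizes : cmd :=
  Seq (Seq (Assign rn (Read (Const 0))) (Assign rQ (Const 1)))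
      (count_loop (Reg rn) size_body).

Definition pow_cond : expr := Read (e_pows m + Reg rK) <= Reg rn.

Definition prog_pows : cmd :=
  Seq (Seq (Store (e_pows m) (Const 1)) (Assign rK (Const 0)))
      (While pow_cond pow_body).

Definition prog_counts : cmd := count_loop (Reg rn) count_body.
Definition prog_halves : cmd := count_loop (Reg rK * e_types m) halve_body.
Definition prog_layer0 : cmd := count_loop (e_states m) layer0_body.

End Programs.

Section Preprocessing.

Variables (m n : nat) (I : instance m n) (b : nat).

Local Notation K := (bits n).
Local Notation Q := (nsizes I).
Local Notation NT := (ntypes m Q).
Local Notation NS := (nslots m Q).
Local Notation V := (nstates m Q).
Local Notation Nc := (type_count I).
Local Notation L := (K * nlayers m Q).

Notation adP := (adP m n).
Notation adN := (adN m n).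
Notation adX := (adX I).
Notation adG := (adG I).

(** A common bound for all loop limits and all contents of registers and cells: powers of two up to
    [2 * n], makespans up to [n * Q], indices of halvings and of table cells, choices up to [m].
    Addresses occur only inside expressions, where [kexpr] accounts for them. *)
Definition max_value : nat := 3 * n + Q + n * Q + K * NT + L.+1 * V + m + 3.

Hypotheses (m_gt0 : 0 < m) (n_gt0 : 0 < n) (b_gt0 : 0 < b) (max_lt : max_value < 2 ^ b).

Lemma small x : x <= max_value -> x < 2 ^ b.
Proof. by move=> le_x; apply: leq_ltn_trans max_lt. Qed.

Ltac small := apply: small; rewrite /max_value; lia.

Lemma K_le_n : K <= n.
Proof. by rewrite bits_leP //; apply: ltn_expl. Qed.

Lemma bounded_input : bounded b (input I).
Proof.
split=> x /=; first by rewrite expn_gt0.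
apply: small; apply: leq_trans (word_bound I x) _.
by rewrite /max_value -/Q; lia.
Qed.

Lemma run_sizes : exists s,
  [/\ runs (prog_sizes m) (input I)
        ((kcmd (Seq (Assign rn (Read (Const 0))) (Assign rQ (Const 1)))
          + kloop (Reg rn) (size_body m) * n.+1) * b) s,
      reg s rn = n /\ reg s rQ = Q, mem s =1 word I & bounded b s].
Proof.
set s0 := run (Seq (Assign rn (Read (Const 0))) (Assign rQ (Const 1))) (input I).
have R0 := runs_run b_gt0 (isT : loop_free (Seq (Assign rn (Read (Const 0))) (Assign rQ (Const 1))))
  bounded_input (erefl s0).
have B0 : bounded b s0.
  have [Br Bm] := bounded_input; split=> //=; rewrite !evalE.
  by do !apply: below_update => //; small.
pose P i s := [/\ reg s rn = n, reg s rQ = (\max_(j < i) word I (first_word m j)).+1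
                & mem s =1 word I].
have [||||||s [R [Rn RQ Rm] B]] := @runs_count b (Reg rn) (size_body m) n P s0 b_gt0.
- by [].
- by small.
- by [].
- by split=> //=; rewrite big_ord0.
- by move=> i s _ [Rn _ _] _.
- move=> i s lt_i [Rn RQ Rm] Rj [Br Bm].
  rewrite /= eval_cond eval_leq lt0b !eval_add !eval_read !eval_reg !eval_first !eval_reg Rj Rm RQ.
  have E : (if (\max_(j < i) word I (first_word m j)).+1 <= word I (first_word m i)
            then word I (first_word m i) + eval s (Const 1)
            else (\max_(j < i) word I (first_word m j)).+1)
     = (\max_(j < i.+1) word I (first_word m j)).+1.
    by rewrite big_ord_recr /= eval_const addn1 /maxn; case: ifP.
  rewrite E; split=> //; split=> //; apply: below_update => //.
  apply: small; apply: leq_trans (_ : Q <= _); last by rewrite /max_value; lia.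
  rewrite ltnS; apply/bigmax_leqP => j _.
  have lt_j := leq_trans (ltn_ord j) lt_i.
  by have := size_lt I (Ordinal lt_j); rewrite -word_size.
exists s; split=> //.
  by rewrite mulnDl; exact: runs_seq R0 R.
split=> //; rewrite RQ; congr _.+1; apply: eq_bigr => j _; exact: word_size.
Qed.

(** The loop ends at the first power of two above [n], which makes [rK] equal to [bits n]. That the
    memory further on is still zero is handed from stage to stage, so that counters need no
    initialization. *)
Lemma run_pows s0 :
  bounded b s0 -> reg s0 rn = n -> reg s0 rQ = Q -> mem s0 =1 word I ->
  exists s,
  [/\ runs (prog_pows m) s0
        ((kcmd (Seq (Store (e_pows m) (Const 1)) (Assign rK (Const 0)))
          + (kcmd (pow_body m) + kexpr (pow_cond m)) * K.+1) * b) s,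
      params I s, bounded b s
    & [/\ forall a, a < adP -> mem s a = word I a,
          forall k, k <= K -> mem s (adP + k) = 2 ^ k
        & forall a, adN <= a -> mem s a = 0]].
Proof.
move=> B0 Rn RQ Rm.
set c0 := Seq _ _; pose s1 := run c0 s0.
have R0 := runs_run b_gt0 (isT : loop_free c0) B0 (erefl s1).
have EP : eval s0 (e_pows m) = adP by exact: eval_pows.
have B1 : bounded b s1.
  have [Br Bm] := B0; split=> //=; rewrite !eval_const.
    by apply: below_update => //; small.
  by apply: below_update => //; small.
pose P i s := [/\ reg s rn = n, reg s rQ = Q, reg s rK = i, bounded b s
  & [/\ forall a, a < adP -> mem s a = word I a,
         forall k, k <= i -> mem s (adP + k) = 2 ^ k
        & forall a, adP + i < a -> mem s a = 0]].
have Pb i s : P i s -> bounded b s by case.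
have Pread i s : P i s -> eval s (e_pows m + Reg rK)%X = adP + i.
  by move=> [H1 _ H2 _ _]; rewrite eval_add (eval_pows _ H1) eval_reg H2.
have Plim i s : i <= K -> P i s -> (eval s (pow_cond m) != 0) = (i < K).
  move=> le_i Pi; have Ei := Pread _ _ Pi; have [H1 H2 H3 _ [_ H4 _]] := Pi.
  rewrite eval_leq eval_read Ei H4 // eval_reg H1 eqb0 negbK.
  by rewrite -ltn_bits.
have Pstep i s : i < K -> P i s ->
    exists2 s', runs (pow_body m) s (kcmd (pow_body m) * b) s' & P i.+1 s'.
  move=> lt_i Pi; have Ei := Pread _ _ Pi; have [H1 H2 H3 B [H4 H5 H6]] := Pi.
  exists (run (pow_body m) s); first exact: runs_run.
  have E1 : eval s (e_pows m + Reg rK + Const 1)%X = adP + i.+1.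
    by rewrite eval_add Ei eval_const addn1 addnS.
  have E2 : eval s (Const 2 * Read (e_pows m + Reg rK))%X = 2 ^ i.+1.
    by rewrite eval_mul eval_read Ei H5 // expnS.
  rewrite /pow_body !runE E1 E2 eval_add eval_reg eval_const /= H3 addn1.
  have lt_2 : 2 ^ i.+1 < 2 ^ b.
    apply: small; have : 2 ^ i <= n by rewrite -ltn_bits.
    by rewrite expnS /max_value; lia.
  case: B => Br Bm; split=> //.
    by split; apply: below_update => //; have le_K := K_le_n; small.
  split=> [a lt_a | k le_k | a lt_a] /=.
  - rewrite update_other ?H4 //; apply/eqP; lia.
  - have [-> | ne] := eqVneq k i.+1; first by rewrite update_same.
    by rewrite update_other ?eqn_add2l // H5 // -ltnS ltn_neqAle ne.
  by rewrite update_other ?H6 //; [lia | apply/eqP; lia].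
have P0 : P 0 s1.
  move: B1; rewrite /s1 /c0 !runE EP !eval_const => B1; split=> //=.
  split=> [a lt_a | k | a lt_a].
  - by rewrite update_other ?Rm //; apply/eqP; lia.
  - by rewrite leqn0 => /eqP ->; rewrite addn0 update_same.
  rewrite update_other; last by apply/eqP; lia.
  by rewrite Rm word_out //; move: lt_a; rewrite /adP; lia.
have [s R [H1 H2 H3 B [H4 H5 H6]]] := runs_for b_gt0 Pb Plim Pstep P0.
exists s; split=> //.
  apply: runs_le (runs_seq R0 R); rewrite -mulnDl leq_mul2r; apply/orP; right.
  by rewrite leq_add2l; move: (kcmd _) (kexpr _) => x y; nia.
by split=> // a le_a; apply: H6; move: le_a; rewrite /adN -/K; lia.
Qed.

Definition prefix (M : nat -> nat) : Prop :=
  (forall a, a < adP -> M a = word I a) /\ (forall k, k <= K -> M (adP + k) = 2 ^ k).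

Lemma prefix_eq M M' : (forall a, a < adN -> M' a = M a) -> prefix M -> prefix M'.
Proof.
move=> E [H1 H2]; split=> [a lt_a | k le_k]; rewrite E; [exact: H1 | | exact: H2 | ];
  by rewrite /adN; lia.
Qed.

Lemma run_counts s0 :
  bounded b s0 -> params I s0 -> prefix (mem s0) -> (forall a, adN <= a -> mem s0 a = 0) ->
  exists s,
  [/\ runs (prog_counts m) s0 (kloop (Reg rn) (count_body m) * n.+1 * b) s,
      bounded b s, params I s, prefix (mem s)
    & (forall T, T < NT -> mem s (adN + T) = Nc T) /\
      (forall a, adN + NT <= a -> mem s a = 0)].
Proof.
move=> B0 Hp0 Hpre0 Hz0.
pose cnt i T := \sum_(j < i) (job_type I j == T).
pose P i s := [/\ params I s, prefix (mem s),
   forall T, T < NT -> mem s (adN + T) = cnt i T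
 & forall a, adN + NT <= a -> mem s a = 0].
have [||||||s [R [Hp Hpre Hc Hz] B]] :=
  @runs_count b (Reg rn) (count_body m) n P s0 b_gt0.
- by [].
- by small.
- by [].
- split=> //= [|T lt_T|a le_a]; first by case: Hp0.
    by rewrite /cnt big_ord0 Hz0 // leq_addr.
  by rewrite Hz0 // (leq_trans _ le_a) // leq_addr.
- by move=> i s _ [Hp _ _ _] _; rewrite eval_reg (param_n Hp).
- move=> i s lt_i [Hp Hpre Hc Hz] Rj [Br Bm].
  have lt_T : job_type I i < NT by exact: (job_type_lt I (Ordinal lt_i)).
  have Ea : eval s (e_halves m + e_job_type m (Reg rj))%X = adN + job_type I i.
    rewrite eval_add (eval_halves Hp) (eval_job_type Hp _ lt_i) ?eval_reg //.
    by move=> a /andP[_ lt_a]; apply: (proj1 Hpre).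
  have Ev : eval s (Read (e_halves m + e_job_type m (Reg rj)) + Const 1)%X
      = (cnt i (job_type I i)).+1 by rewrite eval_add eval_read Ea Hc // eval_const addn1.
  rewrite /count_body runE Ea Ev.
  have cnt_le : cnt i (job_type I i) <= n.
    apply: leq_trans (_ : \sum_(j < i) 1 <= _); first by apply: leq_sum => j _; exact: leq_b1.
    by rewrite sum1_card card_ord ltnW.
  split=> //; first by split=> //; apply: below_update => //; small.
  split=> [||T lt_T'|a le_a] /=; first by case: Hp.
  - by apply: prefix_eq Hpre => a lt_a; rewrite update_other //; apply/eqP; lia.
  - rewrite /cnt big_ord_recr /= -/(cnt i T); have [<- | ne] := eqVneq (job_type I i) T.
      by rewrite update_same addn1.
    by rewrite update_other ?eqn_add2l ?Hc ?addn0 // eq_sym.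
  by rewrite update_other ?Hz //; apply/eqP; lia.
by exists s.
Qed.

Lemma run_halves s0 :
  bounded b s0 -> params I s0 -> prefix (mem s0) ->
  (forall T, T < NT -> mem s0 (adN + T) = Nc T) ->
  (forall a, adN + NT <= a -> mem s0 a = 0) ->
  exists s,
  [/\ runs (prog_halves m) s0
        (kloop (Reg rK * e_types m)%X (halve_body m) * (K * NT).+1 * b) s,
      bounded b s, params I s, prefix (mem s)
    & (forall k T, k <= K -> T < NT -> mem s (adN + (k * NT + T)) = halves m (Nc T) k) /\
      (forall a, adX <= a -> mem s a = 0)].
Proof.
move=> B0 Hp0 Hpre0 Hc0 Hz0.
have NT0 : 0 < NT by exact: ntypes_gt0.
pose P i s := [/\ params I s, prefix (mem s),
   forall a, a < NT + i -> mem s (adN + a) = halves m (Nc (a %% NT)) (a %/ NT)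
 & forall a, adN + NT + i <= a -> mem s a = 0].
have [||||||s [R [Hp Hpre Hc Hz] B]] :=
  @runs_count b (Reg rK * e_types m)%X (halve_body m) (K * NT) P s0 b_gt0.
- by [].
- by small.
- by [].
- split=> //= [|a|a]; rewrite ?addn0; first by case: Hp0.
    by move=> lt_a; rewrite Hc0 // modn_small // divn_small.
  exact: Hz0.
- by move=> i s _ [Hp _ _ _] _; rewrite eval_mul (eval_types Hp) eval_reg (param_K Hp).
- move=> i s lt_i [Hp Hpre Hc Hz] Rj [Br Bm].
  have Ea : eval s (e_halves m + e_types m + Reg rj)%X = adN + (NT + i).
    by rewrite 2!eval_add (eval_halves Hp) (eval_types Hp) eval_reg Rj addnA.
  have Ev : eval s ((Read (e_halves m + Reg rj) - Const m + Const 1) %/ Const 2)%X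
      = halves m (Nc ((NT + i) %% NT)) ((NT + i) %/ NT).
    rewrite eval_div eval_add eval_sub eval_read eval_add (eval_halves Hp) eval_reg Rj.
    rewrite Hc; last by lia.
    have -> : (NT + i) %/ NT = (i %/ NT).+1 by rewrite -{1}[NT]mul1n divnMDl.
    by rewrite modnDl halvesS.
  have Nc_le T : Nc T <= n by exact: type_count_le.
  rewrite /halve_body runE Ea Ev.
  split=> //.
    split=> //; apply: below_update => //; apply: small.
    apply: leq_trans (_ : n <= _); last by rewrite /max_value; lia.
    apply: leq_trans (Nc_le ((NT + i) %% NT)).
    have := halves_bound (Nc ((NT + i) %% NT)) ((NT + i) %/ NT) m_gt0.
    by have := expn_gt0 2 ((NT + i) %/ NT); move: (halves _ _ _) (2 ^ _) => x y; nia.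
  split=> [||a lt_a|a le_a] /=; first by case: Hp.
  - by apply: prefix_eq Hpre => a lt_a; rewrite update_other //; apply/eqP; lia.
  - have [-> | ne] := eqVneq a (NT + i); first by rewrite update_same.
    by rewrite update_other ?eqn_add2l // Hc //; lia.
  by rewrite update_other ?Hz //; [lia | apply/eqP; lia].
exists s; split=> //; split=> [k T le_k lt_T | a le_a].
  rewrite Hc; last by nia.
  by rewrite modnMDl modn_small // divnMDl // divn_small // addn0.
by apply: Hz; move: le_a; rewrite /adX -/Q -/NT; lia.
Qed.

Lemma run_layer0 s0 :
  bounded b s0 -> params I s0 -> prefix (mem s0) ->
  (forall k T, k <= K -> T < NT -> mem s0 (adN + (k * NT + T)) = halves m (Nc T) k) ->
  (forall a, adX <= a -> mem s0 a = 0) ->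
  exists s,
  [/\ runs (prog_layer0 m) s0 (kloop (e_states m) (layer0_body m) * V.+1 * b) s,
      bounded b s, params I s & tables I (mem s)].
Proof.
move=> B0 Hp0 [Hi0 Hw0] Hh0 Hz0.
pose P i s := [/\ params I s, forall a, a < adG -> mem s a = mem s0 a
 & forall u, u < i -> mem s (adG + u) = 1].
have [||||||s [R [Hp Hm Hu] B]] :=
  @runs_count b (e_states m) (layer0_body m) V P s0 b_gt0.
- by [].
- by small.
- by [].
- by split=> //=; case: Hp0.
- by move=> i s _ [Hp _ _] _; exact: (eval_states Hp).
- move=> i s lt_i [Hp Hm Hu] Rj [Br Bm].
  have Ea : eval s (e_dp m + Reg rj)%X = adG + i by rewrite eval_add (eval_dp Hp) eval_reg Rj.
  rewrite /layer0_body runE Ea eval_const.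
  split=> //; first by split=> //; apply: below_update => //; small.
  split=> [|a lt_a|u lt_u] /=; first by case: Hp.
    by rewrite update_other ?Hm //; apply/eqP; lia.
  have [-> | ne] := eqVneq u i; first by rewrite update_same.
  by rewrite update_other ?eqn_add2l // Hu // -ltnS ltn_neqAle ne.
have le_XG : adX <= adG by exact: leq_addr.
have le_NX : adN <= adX by exact: leq_addr.
have lt_PN := adP_lt_adN m n.
exists s; split=> //; split=> //; first split.
- by move=> a lt_a; rewrite Hm ?Hi0 //; lia.
- by move=> k le_k; rewrite Hm ?Hw0 //; move: le_XG le_NX; rewrite /adN; lia.
- move=> k T le_k lt_T; rewrite Hm ?Hh0 //; apply: leq_trans le_XG.
  by rewrite /adX ltn_add2l; nia.
by move=> a lt_a; rewrite Hm ?Hz0 ?leq_addr // /adG ltn_add2l.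
Qed.

End Preprocessing.

(** * Filling the table and binary search for the makespan *)

Section Programs.

Variable m : nat.

Local Open Scope expr_scope.

Definition dp_body : cmd :=
  Store (e_dp m + e_states m + Reg rj)
        (e_step m (Reg rj %/ e_states m) (Reg rj %% e_states m)).

Definition dp_lim : expr := Reg rK * e_layers m * e_states m.
Definition prog_dp : cmd := count_loop dp_lim dp_body.

Definition search_init : cmd := Seq (Assign rlo (Const 0)) (Assign rhi (Reg rn * Reg rQ)).
Definition search_mid : cmd := Assign rC ((Reg rlo + Reg rhi) %/ Const 2).
Definition search_hi : cmd := Assign rhi (Reg rC).
Definition search_lo : cmd := Assign rlo (Reg rC + Const 1).
Definition search_body : cmd :=
  Seq search_mid (Seq prog_dp (If (e_feasible m) search_hi search_lo)).
Definition prog_search : cmd := Seq search_init (While (Reg rlo < Reg rhi) search_body).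

End Programs.

Section Search.

Variables (m n : nat) (I : instance m n) (b : nat).

Local Notation K := (bits n).
Local Notation Q := (nsizes I).
Local Notation NT := (ntypes m Q).
Local Notation NS := (nslots m Q).
Local Notation V := (nstates m Q).
Local Notation Nc := (type_count I).
Local Notation L := (K * nlayers m Q).
Local Notation adP := (adP m n).
Local Notation adN := (adN m n).
Local Notation adX := (adX I).
Local Notation adG := (adG I).

Hypotheses (m_gt0 : 0 < m) (n_gt0 : 0 < n) (b_gt0 : 0 < b) (max_lt : max_value I < 2 ^ b).

Lemma small_value x : x <= max_value I -> x < 2 ^ b.
Proof. by move=> le_x; apply: leq_ltn_trans max_lt. Qed.

Ltac small := apply: small_value; rewrite /max_value; lia.

Lemma tables_eq M M' : (forall a, a < adG + V -> M' a = M a) -> tables I M -> tables I M'.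
Proof.
have le_XG : adX <= adG by exact: leq_addr.
have le_NX : adN <= adX by exact: leq_addr.
have lt_PN := adP_lt_adN m n.
move=> E [[H1 H2 H3] H4 H5]; split; first split.
- by move=> a lt_a; rewrite E ?H1 //; lia.
- by move=> k le_k; rewrite E ?H2 //; move: le_XG le_NX; rewrite /adN; lia.
- move=> k T le_k lt_T; rewrite E ?H3 // ltn_addr //; apply: leq_trans le_XG.
  by rewrite /adX ltn_add2l; nia.
- by move=> a lt_a; rewrite E ?H4 // ltn_addr // /adG ltn_add2l.
by move=> u lt_u; rewrite E ?H5 // ltn_add2l.
Qed.

Lemma dp_le C l u : dp m Q Nc C l u <= m.
Proof.
elim: l u => [|l IH] u //=; rewrite /dp_step.
by case: ifP => // _; case: ifP => // _; exact: pick_below_le.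
Qed.

Lemma run_dp s0 C :
  bounded b s0 -> params I s0 -> tables I (mem s0) -> reg s0 rC = C ->
  exists s,
  [/\ runs (prog_dp m) s0 (kloop (dp_lim m) (dp_body m) * (L * V).+1 * b) s,
      bounded b s, params I s, tables I (mem s)
    & dp_cells I C (L.+1 * V) (mem s) /\ forall x, x != rj -> reg s x = reg s0 x].
Proof.
move=> B0 Hp0 Ht0 EC; have V0 : 0 < V by exact: base_exp_gt0.
pose P i s := [/\ params I s, tables I (mem s), forall x, x != rj -> reg s x = reg s0 x
   & dp_cells I C (V + i) (mem s)].
have [||||||s [R [Hp Ht Hr Hd] B]] := @runs_count b (dp_lim m) (dp_body m) (L * V) P s0 b_gt0.
- by [].
- by small.
- by [].
- split=> //; first by case: Hp0.
    by move=> x ne /=; rewrite update_other.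
  move=> a; rewrite addn0 => lt_a /=.
  by rewrite divn_small ?modn_small //= (table_layer0 Ht0).
- move=> i s _ [Hp _ _ _] _.
  by rewrite 2!eval_mul (eval_layers Hp) (eval_states Hp) eval_reg (param_K Hp).
- move=> i s lt_i [Hp Ht Hr Hd] Rj [Br Bm].
  have Ea : eval s (e_dp m + e_states m + Reg rj)%X = adG + (V + i).
    by rewrite 2!eval_add (eval_dp Hp) (eval_states Hp) eval_reg Rj addnA.
  have El : eval s (Reg rj %/ e_states m)%X = i %/ V.
    by rewrite eval_div (eval_states Hp) eval_reg Rj.
  have Eu : eval s (Reg rj %% e_states m)%X = i %% V.
    by rewrite eval_mod (eval_states Hp) eval_reg Rj.
  have Ev : eval s (e_step m (Reg rj %/ e_states m)%X (Reg rj %% e_states m)%X)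
      = dp m Q Nc C (i %/ V).+1 (i %% V).
    apply: (eval_step m_gt0 Hp (table_static Ht)) => //.
    - by rewrite Hr.
    - by rewrite ltn_divLR.
    - exact: ltn_pmod.
    by move=> a lt_a; apply: Hd; apply: leq_trans lt_a _; rewrite mulSn leq_add2l leq_divM.
  rewrite /dp_body runE Ea Ev.
  have lt_v := dp_le C (i %/ V).+1 (i %% V).
  split=> //.
    split=> //; apply: below_update => //; apply: small_value; apply: leq_trans lt_v _.
    by rewrite /max_value; lia.
  split=> [||x ne|a lt_a]; first by case: Hp.
  - by apply: tables_eq Ht => a lt_a /=; rewrite update_other //; apply/eqP; lia.
  - by rewrite /= update_other // Hr.
  move=> /=; have [-> | ne] := eqVneq a (V + i).
    rewrite update_same; have -> : (V + i) %/ V = (i %/ V).+1 by rewrite -{1}[V]mul1n divnMDl.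
    by rewrite modnDl.
  by rewrite update_other ?eqn_add2l // Hd //; lia.
exists s; split=> //; split=> //.
Qed.

(** The lower bound speaks of schedules and the upper one of the dynamic program: failure at a value
    excludes schedules up to it, by completeness, and success is recorded as such. The initial [hi]
    is not tested, as the instance may have no schedule at all. *)
Definition searching (lo hi : nat) : Prop :=
  [/\ lo <= hi <= n * Q,
      forall sigma, is_schedule I sigma -> lo <= makespan I sigma
    & hi = n * Q \/ 0 < dp m Q Nc hi L (dp_start m Q K hi)].

Definition ksearch : nat :=
  kcmd (search_mid) + kloop (dp_lim m) (dp_body m)
  + (kexpr (e_feasible m) + (kcmd search_hi + kcmd search_lo)) + kexpr (Reg rlo < Reg rhi)%X.

Lemma dp_of_schedule_bits C sigma : is_schedule I sigma -> makespan I sigma <= C ->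
  0 < dp m Q Nc C L (dp_start m Q K C).
Proof. by apply: dp_of_schedule => //; exact: ltn_exp_bits. Qed.

Lemma run_search s0 :
  bounded b s0 -> params I s0 -> tables I (mem s0) ->
  exists s,
  [/\ runs (prog_search m) s0
        ((kcmd search_init + (bits (n * Q)).+1 * (ksearch * (L * V).+1)) * b) s,
      bounded b s, params I s, tables I (mem s)
    & reg s rhi = reg s rlo /\ searching (reg s rlo) (reg s rlo)].
Proof.
move=> B0 Hp0 Ht0; have V0 : 0 < V by exact: base_exp_gt0.
(* Each round halves the interval, so an interval shorter than [2 ^ k] needs at most [k] rounds. *)
pose P k s := [/\ bounded b s, params I s, tables I (mem s),
  searching (reg s rlo) (reg s rhi) & reg s rhi - reg s rlo < 2 ^ k].
pose s1 := run search_init s0.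
have R0 := runs_run b_gt0 (isT : loop_free search_init) B0 (erefl s1).
have P1 : P (bits (n * Q)) s1.
  have -> : s1 = State (update (update (reg s0) rlo 0) rhi (n * Q)) (mem s0).
    rewrite /s1 /search_init !runE eval_mul; congr (State (update _ _ (_ * _)) _).
      exact: (param_n Hp0).
    exact: (param_Q Hp0).
  split=> //=; first split=> /=.
  - case: B0 => Br _; do 2!(apply: below_update; last by small).
    exact: Br.
  - by case: B0.
  - by case: Hp0.
  - by split; [rewrite leqnn | | left].
  by rewrite /= subn0; exact: ltn_exp_bits.
have Pb k s : P k s -> bounded b s by case.
have Pstep k s : P k s -> eval s (Reg rlo < Reg rhi)%X != 0 ->
    0 < k /\ exists2 s', runs (search_body m) s
      ((kcmd search_mid + (kloop (dp_lim m) (dp_body m) * (L * V).+1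
          + (kexpr (e_feasible m) + (kcmd search_hi + kcmd search_lo)))) * b) s' & P k.-1 s'.
  move=> [B Hp Ht [/andP[le1 le2] Hlo Hhi] lt_k]; rewrite eval_ltn !eval_reg eqb0 negbK => lt_lh.
  have k0 : 0 < k by case: k lt_k => // lt_k; lia.
  split=> //; have Ek : 2 ^ k = 2 * 2 ^ k.-1 by rewrite -expnS prednK.
  pose C := (reg s rlo + reg s rhi) %/ 2.
  have C_ge : reg s rlo <= C by rewrite /C; lia.
  have C_lt : C < reg s rhi by rewrite /C; lia.
  have C_lt2 : C - reg s rlo < 2 ^ k.-1 by rewrite /C; lia.
  have C_lt3 : reg s rhi - C.+1 < 2 ^ k.-1 by rewrite /C; lia.
  pose s2 := run search_mid s.
  have R2 := runs_run b_gt0 (isT : loop_free search_mid) B (erefl s2).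
  have E2 : s2 = State (update (reg s) rC C) (mem s) by [].
  have B2 : bounded b s2.
    rewrite E2; case: B => Br Bm; split=> //=; apply: below_update => //.
    by apply: leq_ltn_trans (Br rhi); exact: ltnW.
  have Hp2 : params I s2 by rewrite E2; case: Hp.
  have [s3 [R3 B3 Hp3 Ht3 [Hd3 Hr3]]] := run_dp B2 Hp2 Ht (erefl C).
  have EC : reg s3 rC = C by rewrite Hr3.
  have Elo : reg s3 rlo = reg s rlo by rewrite Hr3.
  have Ehi : reg s3 rhi = reg s rhi by rewrite Hr3.
  have Ef := eval_feasible Hp3 (table_static Ht3) EC Hd3.
  have [s4 R4 P4] : exists2 s4,
      runs (if eval s3 (e_feasible m) != 0 then search_hi else search_lo) s3
           ((kcmd search_hi + kcmd search_lo) * b) s4 & P k.-1 s4.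
    rewrite Ef; case: eqP => [dp0 | /eqP dp1] /=.
      exists (run search_lo s3).
        apply: runs_le (runs_run (c := search_lo) b_gt0 isT B3 (erefl _)).
        by rewrite leq_mul2r leq_addl orbT.
      rewrite /search_lo runE eval_add !eval_reg EC eval_const addn1.
      split=> //=; first split=> /=.
      - case: B3 => Br _; apply: below_update => //.
        by apply: leq_ltn_trans (Br rhi); rewrite Ehi.
      - by case: B3.
      - by case: Hp3.
      - rewrite update_same update_other // Ehi; split=> //; first by rewrite C_lt.
        move=> sigma sched; rewrite ltnNge; apply/negP => le_C.
        by have := dp_of_schedule_bits sched le_C; rewrite dp0.
      by rewrite update_same update_other // Ehi.
    exists (run search_hi s3).
      apply: runs_le (runs_run (c := search_hi) b_gt0 isT B3 (erefl _)).
      by rewrite leq_mul2r leq_addr orbT.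
    rewrite /search_hi runE eval_reg EC.
    split=> //=; first split=> /=.
    - by case: B3 => Br _; apply: below_update => //; rewrite -EC.
    - by case: B3.
    - by case: Hp3.
    - rewrite update_same update_other // Elo; split=> //; last by right; rewrite lt0n.
      by rewrite C_ge (leq_trans (ltnW C_lt)).
    by rewrite update_same update_other // Elo.
  exists s4 => //.
  apply: runs_le (runs_seq R2 (runs_seq R3 (runs_if b_gt0 B3 R4))).
  by rewrite !mulnDl !mulnDr !mulnDl.
have [s R [k [B Hp Ht Hs lt_k] e0]] := runs_while b_gt0 Pb Pstep P1.
move: e0; rewrite eval_ltn !eval_reg => /eqP; rewrite eqb0 -leqNgt => le_hl.
have Elh : reg s rhi = reg s rlo by case: Hs => /andP[le1 _] _ _; lia.
exists s; split=> //; last by rewrite Elh in Hs.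
apply: runs_le (runs_seq R0 R); rewrite -mulnDl leq_mul2r leq_add2l /ksearch; apply/orP; right.
move: (kcmd _) (kloop _ _) (kexpr (e_feasible m)) (kcmd _) (kcmd _) (kexpr _) (bits _).
move=> x1 x2 x3 x4 x5 x6 x7.
move: (L * V) => y; nia.
Qed.

End Search.

(** * Recovering a schedule from the table *)

Section Programs.

Variable m : nat.

Local Open Scope expr_scope.

Definition rebuild_lim : expr := Reg rK * e_layers m.
(** The loop index counts up, but the layers are traversed from the highest to the lowest, as the
    bundles are placed from the largest to the smallest. *)
Definition e_layer : expr := rebuild_lim - Reg rj - Const 1.
Definition e_cell : expr := e_counts m + (e_typ m e_layer * Const m + Reg rc).
Definition rebuild_choice : cmd := Assign rc (e_read_dp m (e_layer + Const 1) (Reg ru) - Const 1).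
Definition rebuild_add : cmd := Store e_cell (Read e_cell + e_pow m e_layer).
(** The sum selects the power of the base with exponent [rc]: the machine has no exponentiation, and
    [epow] takes a fixed exponent only. *)
Definition rebuild_sub : cmd :=
  Assign ru (Reg ru - e_psize m e_layer
                      * esum (fun i => (Reg rc == Const i) * epow (e_base m) i) m).
Definition rebuild_refine : cmd := Assign ru (e_refine m e_layer (Reg ru)).
Definition rebuild_body : cmd :=
  If (e_pos m e_layer < e_slots m)
     (If (e_active m e_layer)
         (Seq rebuild_choice (Seq rebuild_add rebuild_sub)) Skip)
     rebuild_refine.
Definition prog_rebuild : cmd :=
  Seq (Assign ru (e_start m)) (count_loop rebuild_lim rebuild_body).

Definition e_count : expr := e_counts m + (Reg rT * Const m + Reg rc).
Definition assign_type : cmd := Assign rT (e_job_type m (Reg rj)).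
Definition assign_choice : cmd :=
  Assign rc (epick (fun i => Read (e_counts m + (Reg rT * Const m + Const i))) m - Const 1).
Definition assign_dec : cmd := Store e_count (Read e_count - Const 1).
Definition assign_out : cmd := Store (Reg rj + Const 1) (Reg rc).
Definition assign_body : cmd :=
  Seq assign_type (Seq assign_choice (Seq assign_dec assign_out)).
Definition prog_assign : cmd := count_loop (Reg rn) assign_body.

End Programs.

Section Output.

Variables (m n : nat) (I : instance m n) (b : nat).

Local Notation K := (bits n).
Local Notation Q := (nsizes I).
Local Notation NT := (ntypes m Q).
Local Notation NS := (nslots m Q).
Local Notation V := (nstates m Q).
Local Notation Nc := (type_count I).
Local Notation L := (K * nlayers m Q).
Local Notation adP := (adP m n).
Local Notation adN := (adN m n).
Local Notation adX := (adX I).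
Local Notation adG := (adG I).

Hypotheses (m_gt0 : 0 < m) (n_gt0 : 0 < n) (b_gt0 : 0 < b) (max_lt : max_value I < 2 ^ b).

Ltac small := apply: (small_value max_lt); rewrite /max_value; lia.

Lemma statics_eq M M' : (forall a, a < adX -> M' a = M a) -> statics I M -> statics I M'.
Proof.
have le_NX : adN <= adX by exact: leq_addr.
have lt_PN := adP_lt_adN m n.
move=> E [H1 H2 H3]; split.
- by move=> a lt_a; rewrite E ?H1 //; lia.
- by move=> k le_k; rewrite E ?H2 //; move: le_NX; rewrite /adN; lia.
by move=> k T le_k lt_T; rewrite E ?H3 // /adX ltn_add2l; nia.
Qed.

Lemma Nc_lt_pow T : T < NT -> Nc T < 2 ^ K.
Proof. by move=> _; apply: leq_ltn_trans (type_count_le I T) _; exact: ltn_exp_bits. Qed.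

Lemma eval_layer s i : params I s -> reg s rj = i -> eval s (e_layer m) = L - i.+1.
Proof.
move=> Hp Rj; rewrite 2!eval_sub eval_mul (eval_layers Hp) !eval_reg Rj (param_K Hp).
by rewrite eval_const; lia.
Qed.

Lemma run_rebuild s0 C :
  bounded b s0 -> params I s0 -> tables I (mem s0) -> reg s0 rC = C ->
  dp_cells I C (L.+1 * V) (mem s0) -> 0 < dp m Q Nc C L (dp_start m Q K C) ->
  exists s,
  [/\ runs (prog_rebuild m) s0
        ((kcmd (Assign ru (e_start m)) + kloop (rebuild_lim m) (rebuild_body m) * L.+1) * b) s,
      bounded b s, params I s, forall a, a < adP -> mem s a = word I a
    & exists u, partial m Q Nc C 0 u (fun a => mem s (adX + a))].
Proof.
move=> B0 Hp0 Ht0 EC0 Hd0 dp0; have Q0 : 0 < Q by [].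
have V0 : 0 < V by exact: base_exp_gt0.
pose c0 := Assign ru (e_start m); pose s1 := run c0 s0.
have R0 := runs_run b_gt0 (isT : loop_free c0) B0 (erefl s1).
have E1 : s1 = State (update (reg s0) ru (dp_start m Q K C)) (mem s0).
  by rewrite /s1 /c0 runE (eval_start Hp0 (table_static Ht0) EC0).
have lt_VM : V <= max_value I by rewrite /max_value mulSn; lia.
have B1 : bounded b s1.
  case: B0 => Br Bm; rewrite E1; split=> //=; apply: below_update => //.
  by apply: (small_value max_lt); apply: leq_trans lt_VM; exact: ltnW (dp_start_lt _ _ _ _).
have Hp1 : params I s1 by rewrite E1; case: Hp0.
pose P i s := [/\ params I s, reg s rC = C, forall a, a < adX -> mem s a = mem s0 a,
   forall a, adG <= a -> mem s a = mem s0 a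
 & partial m Q Nc C (L - i) (reg s ru) (fun a => mem s (adX + a))].
have [||||||s [R [Hp EC Hm1 Hm2 Hpart] B]] :=
  @runs_count b (rebuild_lim m) (rebuild_body m) L P s1 b_gt0.
- by [].
- apply: (small_value max_lt); rewrite /max_value mulSn.
  by apply: leq_trans (leq_pmulr L V0) _; lia.
- by [].
- rewrite E1; split=> //=; first by case: Hp0.
  rewrite subn0; apply: (partial_eq m_gt0 Q0) (partial_init m_gt0 Q0 Nc_lt_pow dp0) => a lt_a /=.
  by rewrite (table_count Ht0).
- by move=> i s _ [Hp _ _ _ _] _; rewrite eval_mul (eval_layers Hp) eval_reg (param_K Hp).
- move=> i s lt_i [Hp EC Hm1 Hm2 Hpart] Rj [Br Bm].
  have Hst : statics I (mem s) by apply: statics_eq Hm1 (table_static Ht0).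
  have El := eval_layer Hp Rj.
  set l := L - i.+1 in El *; have El1 : L - i = l.+1 by rewrite /l; lia.
  rewrite El1 in Hpart; have lt_l : l < L by rewrite /l; lia.
  have Hu := partial_lt Hpart.
  rewrite /rebuild_body run_if eval_ltn (eval_pos _ Hp) (eval_slots Hp) El eqb0 negbK.
  case: ifPn => lt_p; last first.
    rewrite /rebuild_refine runE (eval_refine _ Hp Hst EC) El // eval_reg.
    have lt_r : refine m Q C l (reg s ru) < V by exact: refine_lt.
    split=> //.
      split=> //=; apply: below_update => //.
      by apply: (small_value max_lt); apply: leq_trans lt_VM; exact: ltnW.
    split=> //=; first by case: Hp.
    exact: (partial_refine m_gt0 Q0 lt_p Hpart).
  rewrite run_if (eval_active m_gt0 Hp Hst El lt_l lt_p) eqb0 negbK.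
  case: ifPn => act; last first.
    split=> //=; split=> //=; first by case: Hp.
    exact: partial_skip.
  have [lt_c le_d Hpart'] := partial_place m_gt0 lt_p act Hpart.
  set c := (dp m Q Nc C l.+1 (reg s ru)).-1 in lt_c le_d Hpart'.
  set q := psize Q (typ m Q l) in le_d Hpart'.
  have lt_T := typ_lt m_gt0 lt_p.
  have lt_a : typ m Q l * m + c < NS by exact: (slot_lt m_gt0 Q0 lt_T lt_c).
  have Ec : eval s (e_read_dp m (e_layer m + Const 1)%X (Reg ru) - Const 1)%X = c.
    rewrite eval_sub (eval_read_dp Hp (l := l.+1) (u := reg s ru)) //; last first.
      by rewrite eval_add El addn1.
    rewrite Hm2 ?leq_addr // (dp_cellsE Hd0) // ?eval_const ?subn1 //.
    apply: leq_trans (_ : l.+2 * V <= _); first by rewrite mulSn addnC ltn_add2r.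
    by rewrite leq_mul2r ltnS lt_l orbT.
  set s2 := State (update (reg s) rc c) (mem s).
  have Hp2 : params I s2 by case: Hp.
  have El2 : eval s2 (e_layer m) = l by exact: (eval_layer Hp2).
  have Ecell : eval s2 (e_cell m) = adX + (typ m Q l * m + c).
    by rewrite eval_add (eval_counts Hp2) eval_add eval_mul (eval_typ _ Hp2) El2 !evalE.
  set v := mem s (adX + (typ m Q l * m + c)) + 2 ^ lev m Q l in Hpart'.
  have Ev : eval s2 (Read (e_cell m) + e_pow m (e_layer m))%X = v.
    rewrite eval_add eval_read Ecell (eval_pow_lev Hp2) ?El2 //.
    exact: lev_lt.
  set s3 := State (reg s2) (update (mem s) (adX + (typ m Q l * m + c)) v).
  have Hp3 : params I s3 by case: Hp.
  have El3 : eval s3 (e_layer m) = l by exact: (eval_layer Hp3).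
  have Eu : eval s3 (Reg ru - e_psize m (e_layer m)
      * esum (fun i => (Reg rc == Const i) * epow (e_base m) i) m)%X
      = reg s ru - q * base m Q ^ c.
    rewrite eval_sub eval_mul (eval_psize _ Hp3) El3 eval_sum; congr (_ - _ * _).
    rewrite (bigD1 (Ordinal lt_c)) //= eval_mul eval_eq eval_pow (eval_base Hp3) eqxx mul1n.
    rewrite big1 ?addn0 // => j ne; rewrite eval_mul eval_eq (_ : _ == _ = false) //.
    by apply: contraNF ne => /eqP E; apply/eqP/val_inj; exact: (esym E).
  have -> : run (Seq (rebuild_choice m) (Seq (rebuild_add m) (rebuild_sub m))) s
      = State (update (update (reg s) rc c) ru (reg s ru - q * base m Q ^ c)) (mem s3).
    rewrite 2!run_seq /rebuild_choice run_assign Ec -/s2.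
    by rewrite /rebuild_add run_store Ecell Ev -/s3 /rebuild_sub run_assign Eu.
  have le_v : v <= n.
    apply: leq_trans (type_count_le I (typ m Q l)).
    rewrite -(partial_rest Hpart' lt_T); apply: leq_trans (leq_addr _ _).
    rewrite (bigD1 (Ordinal lt_c)) //= update_same; exact: leq_addr.
  split=> //=.
    split=> /=; last by apply: below_update => //; small.
    apply: below_update; first by apply: below_update => //; small.
    by apply: leq_ltn_trans (leq_subr _ _) _.
  have lt_XG : adX + (typ m Q l * m + c) < adG by rewrite /adG ltn_add2l.
  split=> [||a lt_a'|a le_a|] //=; first by case: Hp.
  - by rewrite update_other ?Hm1 //; apply/eqP; lia.
  - by rewrite update_other ?Hm2 //; apply/eqP; lia.
  rewrite -/l; apply: (partial_eq m_gt0 Q0) Hpart' => a _.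
  by rewrite /update eqn_add2l.
exists s; split=> //.
- by rewrite mulnDl; exact: runs_seq R0 R.
- move=> a lt_a; rewrite Hm1 ?(static_input (table_static Ht0)) //.
  by apply: leq_trans (leq_addr _ _); have := adP_lt_adN m n; lia.
by exists (reg s ru); rewrite subnn in Hpart.
Qed.

(** The counts serve as budgets: each job takes any machine with a positive count for its type and
    decreases that count. Assigned jobs and remaining budget always add up to the original count.
    The result goes to cells of input that is no longer needed, since the type of the job has been
    read before. *)
Lemma run_output s0 :
  bounded b s0 -> params I s0 -> (forall a, a < adP -> mem s0 a = word I a) ->
  (forall T, T < NT -> \sum_(c < m) mem s0 (adX + (T * m + c)) = Nc T) ->
  exists s,
  [/\ runs (prog_assign m) s0 (kloop (Reg rn) (assign_body m) * n.+1 * b) s,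
      bounded b s, forall j, j < n -> mem s j.+1 < m
    & forall T c, T < NT -> c < m ->
        \sum_(j < n) ((job_type I j == T) && (mem s j.+1 == c)) = mem s0 (adX + (T * m + c))].
Proof.
move=> B0 Hp0 Hm0 Hsum0; have Q0 : 0 < Q by [].
pose P i s := [/\ params I s, forall a, i < a < adP -> mem s a = word I a,
   forall j, j < i -> mem s j.+1 < m,
   forall T c, T < NT -> c < m ->
     \sum_(j < i) ((job_type I j == T) && (mem s j.+1 == c)) + mem s (adX + (T * m + c))
     = mem s0 (adX + (T * m + c))
 & forall T, T < NT ->
     \sum_(j < i) (job_type I j == T) + \sum_(c < m) mem s (adX + (T * m + c)) = Nc T].
have [||||||s [R [Hp Hw Hlt Hc Hsum] B]] :=
  @runs_count b (Reg rn) (assign_body m) n P s0 b_gt0.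
- by [].
- by small.
- by [].
- split=> //= [|a /andP[_ lt_a]|T c lt_T lt_c|T lt_T].
  + by case: Hp0.
  + exact: Hm0.
  + by rewrite big_ord0.
  + by rewrite big_ord0 Hsum0.
- by move=> i s _ [Hp _ _ _ _] _; rewrite eval_reg (param_n Hp).
- move=> i s lt_i [Hp Hw Hlt Hc Hsum] Rj [Br Bm].
  set T := job_type I i.
  have lt_T : T < NT by exact: (job_type_lt I (Ordinal lt_i)).
  have ET : eval s (e_job_type m (Reg rj)) = T.
    exact: (eval_job_type (e := Reg rj) Hp Rj lt_i Hw).
  set s1 := State (update (reg s) rT T) (mem s).
  have Hp1 : params I s1 by case: Hp.
  pose f c := 0 < mem s (adX + (T * m + c)).
  set c := (pick_below f m).-1.
  (* Job [i] itself is not yet assigned, so fewer than [Nc T] jobs of its type are, and some budget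
     of this type is left. *)
  have pick_gt0 : 0 < pick_below f m.
    have : 0 < \sum_(c < m) mem s (adX + (T * m + c)).
      have := Hsum T lt_T.
      have : \sum_(j < i) (job_type I j == T) < Nc T.
        have := leq_sum_prefix (fun j => nat_of_bool (job_type I j == T)) lt_i.
        apply: leq_trans; by rewrite big_ord_recr /= eqxx addn1.
      by lia.
    rewrite lt0n sum_nat_eq0 => /forallPn[c' /=]; rewrite -lt0n => fc'.
    by apply: (pick_below_gt0 (ltn_ord c')).
  have lt_c : c < m by rewrite /c prednK //; exact: pick_below_le.
  have f_c : 0 < mem s (adX + (T * m + c)) by exact: (pick_belowP pick_gt0).
  have Ec : eval s1 (epick (fun i => Read (e_counts m + (Reg rT * Const m + Const i))%X) m
                     - Const 1)%X = c.
    rewrite eval_sub eval_pick eval_const subn1; congr _.-1; apply: eq_pick_below => c' _.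
    by rewrite eval_read eval_add (eval_counts Hp1).
  set s2 := State (update (reg s1) rc c) (mem s).
  have Hp2 : params I s2 by case: Hp.
  have Ea : eval s2 (e_count m) = adX + (T * m + c).
    by rewrite eval_add (eval_counts Hp2).
  set v := (mem s (adX + (T * m + c))).-1.
  have Ev : eval s2 (Read (e_count m) - Const 1)%X = v.
    by rewrite eval_sub eval_read Ea eval_const subn1.
  set s3 := State (reg s2) (update (mem s) (adX + (T * m + c)) v).
  have Ej : eval s3 (Reg rj + Const 1)%X = i.+1.
    by rewrite eval_add eval_const addn1; congr _.+1.
  have lt_jP : i.+1 < adP by rewrite /adP; nia.
  have le_PX : adP <= adX by apply: leq_trans (leq_addr _ _); have := adP_lt_adN m n; lia.
  have -> : run (assign_body m) s = State (reg s2) (update (mem s3) i.+1 c).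
    rewrite /assign_body !run_seq /assign_type run_assign ET -/s1.
    rewrite /assign_choice run_assign Ec -/s2.
    by rewrite /assign_dec run_store Ea Ev -/s3 /assign_out run_store Ej.
  set M := update (mem s3) i.+1 c.
  have M_cell a : M (adX + a) = if a == T * m + c then v else mem s (adX + a).
    rewrite /M update_other; last by apply/eqP; lia.
    by rewrite /s3 /= /update eqn_add2l.
  have M_old j : j < i -> M j.+1 = mem s j.+1.
    by move=> lt_j; rewrite /M /s3 /= !update_other //; apply/eqP; lia.
  have M_new : M i.+1 = c by rewrite /M update_same.
  split=> //=.
    split=> /=.
      apply: below_update; last by small.
      apply: below_update => //.
      have leNT : NT <= K * NT by rewrite leq_pmull.
      by small.
    apply: below_update; last by small.
    by apply: below_update => //; apply: leq_ltn_trans (leq_pred _) _.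
  split=> [|a /andP[lt_a lt_aP]|j|T' c' lt_T' lt_c'|T' lt_T'] /=.
  + by case: Hp.
  + rewrite -/M /M /s3 /= !update_other ?Hw //; apply/eqP; lia.
  + rewrite -/M ltnS leq_eqVlt => /orP[/eqP -> | lt_j]; first by rewrite M_new.
    by rewrite M_old ?Hlt.
  + rewrite -/M -(Hc T' c' lt_T' lt_c') big_ord_recr /= M_new M_cell slot_inj //.
    under eq_bigr => j _ do rewrite M_old //.
    rewrite -addnA; congr (_ + _); rewrite -/T [T' == T]eq_sym [c' == c]eq_sym.
    by case: andP => [[/eqP <- /eqP <-] | _] //; rewrite add1n prednK.
  rewrite -/M -(Hsum T' lt_T') big_ord_recr /= -addnA; congr (_ + _).
  under eq_bigr => c' _ do rewrite M_cell slot_inj //.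
  rewrite -/T [T' == T]eq_sym; have [<- /= | ne] := eqVneq T T'; last by [].
  rewrite (bigD1 (Ordinal lt_c)) //= eqxx [RHS](bigD1 (Ordinal lt_c)) //= addnA add1n prednK //.
  by congr (_ + _); apply: eq_bigr => c' /negPf; rewrite -val_eqE /= => ->.
exists s; split=> // T c lt_T lt_c; rewrite -(Hc T c lt_T lt_c).
(* All [Nc T] jobs of the type are assigned, so its budget is used up. *)
have : \sum_(c < m) mem s (adX + (T * m + c)) = 0.
  by apply: (@addnI (Nc T)); rewrite addn0 -{2}(Hsum T lt_T).
move/eqP; rewrite sum_nat_eq0 => /forallP/(_ (Ordinal lt_c))/eqP /= ->.
by rewrite addn0.
Qed.

End Output.

(** * The whole program *)

Definition prog_tail (m : nat) : cmd :=
  Seq (prog_rebuild m) (Seq (prog_assign m) (Store (Const 0) (Const 1))).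

(** The table is that of the last makespan tested, if any, which need not be the one found, so it is
    filled again; the outcome also tells whether there is a schedule. *)
Definition prog_final (m : nat) : cmd :=
  Seq (Assign rC (Reg rlo))
      (Seq (prog_dp m) (If (e_feasible m) (prog_tail m) (Store (Const 0) (Const 0)))).

Definition prog (m : nat) : cmd :=
  Seq (prog_sizes m) (Seq (prog_pows m) (Seq (prog_counts m) (Seq (prog_halves m)
    (Seq (prog_layer0 m) (Seq (prog_search m) (prog_final m)))))).

(** Sums up the stages of [prog] in their order: each takes a constant times a quantity below the
    common bound [w]; [s * d] stands for the rounds of the search times the size of the table. *)
Lemma stage_sum x1 x2 x3 x4 x5 x6 x7 x8 x9 x10 x11 x12 x13 x14 w n K T V s d :
  1 <= w -> n <= w -> K <= w -> T <= w -> V <= w -> s * d <= w -> d <= w ->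
  x1 + x2 * n + (x3 + x4 * K + (x5 * n + (x6 * T + (x7 * V + (x8 + s * (x9 * d)
    + (x10 + (x11 * d + (x12 + (x13 + x14) * w))))))))
  <= (x1 + x2 + x3 + x4 + x5 + x6 + x7 + (x8 + x9) + x10 + x11 + x12 + x13 + x14) * w.
Proof.
move=> w1 wn wK wT wV wsd wd.
have up x y : y <= w -> x * y <= x * w by rewrite leq_mul2l orbC => ->.
rewrite (mulnCA s); have := (up x1 _ w1, up x3 _ w1, up x8 _ w1, up x10 _ w1, up x12 _ w1).
have := (up x2 _ wn, up x4 _ wK, up x5 _ wn, up x6 _ wT, up x7 _ wV, up x9 _ wsd, up x11 _ wd).
move=> [[[[[[h1 h2] h3] h4] h5] h6] h7] [[[[h8 h9] h10] h11] h12].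
move: h6; move: (s * d) (x9 * (s * d)) => _ y h6.
by rewrite !mulnDl; lia.
Qed.

Section Program.

Variables (m n : nat) (I : instance m n) (b : nat).

Local Notation K := (bits n).
Local Notation Q := (nsizes I).
Local Notation NT := (ntypes m Q).
Local Notation V := (nstates m Q).
Local Notation L := (K * nlayers m Q).

Hypotheses (m_gt0 : 0 < m) (n_gt0 : 0 < n) (b_gt0 : 0 < b) (max_lt : max_value I < 2 ^ b).

Definition work : nat := n.+1 + (bits (n * Q)).+1 * (L.+1 * V).+1.

Definition ktail : nat :=
  kcmd (Assign ru (e_start m)) + kloop (rebuild_lim m) (rebuild_body m)
  + kloop (Reg rn) (assign_body m) + kcmd (Store (Const 0) (Const 1)).

Lemma run_tail s0 C :
  bounded b s0 -> params I s0 -> tables I (mem s0) -> reg s0 rC = C ->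
  dp_cells I C (L.+1 * V) (mem s0) ->
  0 < dp m Q (type_count I) C L (dp_start m Q K C) ->
  exists s, runs (prog_tail m) s0 (ktail * work * b) s /\
    (mem s 0 = 1 /\ exists sigma : 'I_n -> 'I_m,
       [/\ is_schedule I sigma, makespan I sigma <= C
         & forall j : 'I_n, mem s j.+1 = sigma j]).
Proof.
move=> B0 Hp0 Ht0 EC Hd dp0.
have [s1 [R1 B1 Hp1 Hm1 [u Hpart]]] := run_rebuild m_gt0 n_gt0 b_gt0 max_lt B0 Hp0 Ht0 EC Hd dp0.
have Hsum T : T < NT -> \sum_(c < m) mem s1 (adX I + (T * m + c)) = type_count I T.
  by move=> lt_T; rewrite -(partial_rest Hpart lt_T) /rest big_ord0 addn0.
have [s2 [R2 B2 Hlt Hcnt]] := run_output m_gt0 n_gt0 b_gt0 max_lt B1 Hp1 Hm1 Hsum.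
have R3 := runs_run b_gt0 (isT : loop_free (Store (Const 0) (Const 1))) B2 (erefl _).
eexists; split.
  apply: runs_le (runs_seq R1 (runs_seq R2 R3)).
  rewrite -!mulnDl leq_mul2r; apply/orP; right; rewrite /ktail /work.
  move: (kcmd _) (kloop _ _) (kloop _ _) (kcmd _) => x1 x2 x3 x4.
  have V0 : 0 < V by exact: base_exp_gt0.
  by move: (bits (n * Q)) (L) => y z; nia.
split; first by [].
exists (fun j : 'I_n => Ordinal (Hlt j (ltn_ord j))).
have [sched le_C] := schedule_of_counts (C := C)
  (X := fun a => mem s1 (adX I + a)) (sigma := fun j : 'I_n => Ordinal (Hlt j (ltn_ord j))) Hcnt
  (fun i lt_i => leq_trans (leq_addr _ _) (partial_cap Hpart lt_i))
  (fun T i => partial_flag Hpart (T := T) (i := i)).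
by split.
Qed.

Definition kprog : nat :=
  kcmd (Seq (Assign rn (Read (Const 0))) (Assign rQ (Const 1)))
  + kloop (Reg rn) (size_body m)
  + kcmd (Seq (Store (e_pows m) (Const 1)) (Assign rK (Const 0)))
  + (kcmd (pow_body m) + kexpr (pow_cond m))
  + kloop (Reg rn) (count_body m)
  + kloop (Reg rK * e_types m)%X (halve_body m)
  + kloop (e_states m) (layer0_body m)
  + (kcmd search_init + ksearch m)
  + kcmd (Assign rC (Reg rlo))
  + kloop (dp_lim m) (dp_body m)
  + kexpr (e_feasible m) + ktail + kcmd (Store (Const 0) (Const 0)).

Lemma run_prog : exists s,
  runs (prog m) (input I) (kprog * work * b) s /\ output_correct I s.
Proof.
have [s1 [R1 [Hn1 HQ1] Hw1 B1]] := run_sizes m_gt0 n_gt0 b_gt0 max_lt.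
have [s2 [R2 Hp2 B2 [Hi2 Hk2 Hz2]]] := run_pows m_gt0 n_gt0 b_gt0 max_lt B1 Hn1 HQ1 Hw1.
have [s3 [R3 B3 Hp3 Hpre3 [Hc3 Hz3]]] :=
  run_counts m_gt0 n_gt0 b_gt0 max_lt B2 Hp2 (conj Hi2 Hk2) Hz2.
have [s4 [R4 B4 Hp4 Hpre4 [Hh4 Hz4]]] := run_halves m_gt0 n_gt0 b_gt0 max_lt B3 Hp3 Hpre3 Hc3 Hz3.
have [s5 [R5 B5 Hp5 Ht5]] := run_layer0 m_gt0 n_gt0 b_gt0 max_lt B4 Hp4 Hpre4 Hh4 Hz4.
have [s6 [R6 B6 Hp6 Ht6 [_ Hs6]]] := run_search m_gt0 n_gt0 b_gt0 max_lt B5 Hp5 Ht5.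
set C := reg s6 rlo in Hs6; pose c7 := Assign rC (Reg rlo); pose s7 := run c7 s6.
have R7 := runs_run b_gt0 (isT : loop_free c7) B6 (erefl s7).
have B7 : bounded b s7.
  by case: B6 => Br Bm; split=> //=; apply: below_update => //; exact: Br.
have Hp7 : params I s7 by case: Hp6.
have [s8 [R8 B8 Hp8 Ht8 [Hd8 Hr8]]] := run_dp m_gt0 n_gt0 b_gt0 max_lt B7 Hp7 Ht6 (erefl C).
have EC : reg s8 rC = C by rewrite Hr8.
have Ef := eval_feasible Hp8 (table_static Ht8) EC Hd8.
have [_ Hlo Hhi] := Hs6.
have [s9 R9 Hout] : exists2 s9,
    runs (if eval s8 (e_feasible m) != 0 then prog_tail m else Store (Const 0) (Const 0)) s8
      ((ktail + kcmd (Store (Const 0) (Const 0))) * work * b) s9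
  & output_correct I s9.
  rewrite Ef; case: eqP => [dp0 | /eqP dp1] /=.
    eexists.
      apply: runs_le (runs_run (c := Store (Const 0) (Const 0)) b_gt0 isT B8 (erefl _)).
      by rewrite leq_mul2r mulnDl /work; move: (kcmd _) => x; apply/orP; right; nia.
    (* Failure at the value found means that it is the untested [n * Q]; any schedule has at most
       this makespan and would have led to success. *)
    right; split=> // sigma sched; case: Hhi => [EnQ | ]; last by rewrite dp0.
    have := dp_of_schedule_bits m_gt0 sched (makespan_ub sched).
    by rewrite -EnQ dp0.
  have dp_gt0 : 0 < dp m Q (type_count I) C L (dp_start m Q K C) by rewrite lt0n.
  have [s9 [R9 [H0 [sigma [sched le_C Hsig]]]]] := run_tail B8 Hp8 Ht8 EC Hd8 dp_gt0.
  exists s9; first by apply: runs_le R9; rewrite leq_mul2r leq_mul2r leq_addr !orbT.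
  left; split=> //; exists sigma => //; split=> // tau sched'.
  exact: leq_trans le_C (Hlo _ sched').
exists s9; split=> //.
have R := runs_seq R1 (runs_seq R2 (runs_seq R3 (runs_seq R4 (runs_seq R5 (runs_seq R6
  (runs_seq R7 (runs_seq R8 (runs_if b_gt0 B8 R9)))))))).
apply: runs_le R; rewrite -!mulnDl leq_mul2r; apply/orP; right.
have V0 : 0 < V by exact: base_exp_gt0.
have le_K : K <= n by rewrite bits_leP //; apply: ltn_expl.
have le_NT : K * NT <= L by rewrite leq_mul2l /nlayers /nslots; nia.
have w_n : n.+1 <= work by rewrite /work leq_addr.
have w_L : (bits (n * Q)).+1 * (L.+1 * V).+1 <= work by rewrite /work leq_addl.
have w_dp : (L * V).+1 <= (L.+1 * V).+1 by rewrite ltnS leq_mul2r leqnSn orbT.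
have w_L1 : (L.+1 * V).+1 <= work by apply: leq_trans w_L; rewrite leq_pmull.
have w_s : (bits (n * Q)).+1 * (L * V).+1 <= work.
  by apply: leq_trans w_L; rewrite leq_mul2l w_dp orbT.
have w_V : V.+1 <= work by apply: leq_trans w_L1; rewrite ltnS leq_pmull.
have w_LL : L.+1 <= work by apply: leq_trans w_L1; rewrite ltnS (leq_trans (leqnSn _)) // leq_pmulr.
have w_K : K.+1 <= work by apply: leq_trans w_n.
have w_T : (K * NT).+1 <= work by apply: leq_trans w_LL.
have w_1 : 1 <= work by apply: leq_trans w_n.
by apply: stage_sum => //; exact: leq_trans w_dp w_L1.
Qed.

End Program.

(** * The running time *)

Definition e_max (m : nat) : expr :=
  (Const 3 * Reg rn + Reg rQ + Reg rn * Reg rQ + Reg rK * e_types m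
   + (Reg rK * e_layers m + Const 1) * e_states m + Const m + Const 3)%X.

Section Bounds.

Variables (m n : nat) (I : instance m n).
Hypotheses (m_gt0 : 0 < m) (n_gt0 : 0 < n).

Local Notation Q := (nsizes I).
Local Notation F := (pmax I ^ (2 ^ (m + 1) + 2 * m - 2) + n).

(** The summand 2 pays for the part linear in [n]. The factor 6 is 3 for the number of search rounds
    times 2 for rounding up the table size; the other factors come from the bounds on the layers, on
    the states, and from [nsizes_exp_le]. *)
Definition cwork : nat :=
  2 + 6 * (2 ^ m * m + 2) * (2 ^ m.+1 * m + 1) ^ m * 2 ^ (2 ^ (m + 1) + 2 * m - 2).

Lemma exponent_ge : 2 * m + 1 <= 2 ^ (m + 1) + 2 * m - 2.
Proof.
have : 2 ^ 2 <= 2 ^ (m + 1) by rewrite leq_exp2l // addn1 ltnS.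
by move: (2 ^ (m + 1)) => x; lia.
Qed.

Lemma nsizes_le : Q <= F.
Proof.
have E0 : 0 < 2 ^ (m + 1) + 2 * m - 2 by apply: leq_trans exponent_ge; rewrite addn1.
rewrite /nsizes; case: (posnP (pmax I)) => [-> | p0]; first by rewrite addn_gt0 n_gt0 orbT.
rewrite -addn1; apply: leq_add => //.
by rewrite -{1}[pmax I]expn1 leq_pexp2l.
Qed.

(** The power of two compensates for [pmax I + 1 <= 2 * pmax I]; this fails for [pmax I = 0], but
    then [Q = 1] and the summand [n] of the bound is enough. *)
Lemma nsizes_exp_le : Q ^ (2 * m + 1) <= 2 ^ (2 ^ (m + 1) + 2 * m - 2) * F.
Proof.
have leE := exponent_ge; move: leE; set E := _ - _ => leE.
apply: leq_trans (_ : Q ^ E <= _); first by rewrite leq_pexp2l.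
rewrite /nsizes; case: (posnP (pmax I)) => [-> | p0].
  by rewrite exp1n muln_gt0 expn_gt0 addn_gt0 n_gt0 orbT.
apply: leq_trans (_ : (2 * pmax I) ^ E <= _); first by rewrite leq_exp2r; lia.
by rewrite expnMn leq_mul2l leq_addr orbT.
Qed.

Lemma n_le_F : n <= F. Proof. exact: leq_addl. Qed.

Lemma max_value_lt : max_value I < 2 ^ (kexpr (e_max m) * bits F).
Proof.
(* [max_value I] is the value of a fixed expression in [n], [Q] and [bits n], so
   its length is linear in theirs. *)
pose s := State (fun x => if x == rn then n else if x == rQ then Q
                          else if x == rK then bits n else 0)
                (fun=> 0).
have Hp : params I s by [].
have -> : max_value I = eval s (e_max m).
  rewrite 6!eval_add 3!eval_mul (eval_types Hp) eval_mul (eval_states Hp).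
  by rewrite eval_add eval_mul (eval_layers Hp) !evalE addn1.
apply: eval_bound => //; have ltF := ltn_exp_bits F.
split=> x /=; last by rewrite expn_gt0.
case: ifP => _; first exact: leq_ltn_trans n_le_F ltF.
case: ifP => _; first exact: leq_ltn_trans nsizes_le ltF.
case: ifP => _; last by rewrite expn_gt0.
apply: leq_ltn_trans ltF; apply: leq_trans n_le_F.
by rewrite bits_leP //; exact: ltn_expl.
Qed.

Lemma work_le : work I <= cwork * F * bits F ^ 2.
Proof.
have F0 : 0 < F by exact: leq_trans n_gt0 n_le_F.
set B := bits F; have B0 : 0 < B by [].
have le_nB : bits n <= B by apply: leq_bits; exact: n_le_F.
have le_QB : bits Q <= B by apply: leq_bits; exact: nsizes_le.
have le_s : (bits (n * Q)).+1 <= 3 * B.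
  have : bits (n * Q) <= 2 * B.
    rewrite bits_leP ?muln_gt0 // mul2n -addnn expnD; apply: ltn_mul.
      exact: leq_ltn_trans n_le_F (ltn_exp_bits F).
    exact: leq_ltn_trans nsizes_le (ltn_exp_bits F).
  by move: (bits _) => x; lia.
clearbody B.
have le_V : nstates m Q <= (2 ^ m.+1 * m + 1) ^ m * Q ^ (2 * m).
  rewrite /nstates expnM -expnMn leq_exp2r // /base /cap_max /nslots /ntypes expnS.
  have Q0 : 0 < Q by [].
  by move: (2 ^ m) Q0 => x; move: Q => q Q0; nia.
have le_L : (bits n * nlayers m Q).+1 <= (2 ^ m * m + 2) * (B * Q).
  have Q0 : 0 < Q by [].
  clear le_QB le_s; rewrite /nlayers /nslots /ntypes; move: (2 ^ m) Q0 (bits n) B le_nB B0 => x.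
  move: Q => q q0 k c le_kc c0.
  have := leq_mul le_kc (leqnn (x * q * m).+1); have := leq_mul c0 q0.
  have := leq_pmulr c q0; rewrite mulnS mulnDl => h1 h2 h3.
  by lia.
have le_LV : (bits n * nlayers m Q).+1 * nstates m Q <=
    (2 ^ m * m + 2) * (2 ^ m.+1 * m + 1) ^ m * 2 ^ (2 ^ (m + 1) + 2 * m - 2) * (B * F).
  apply: leq_trans (leq_mul le_L le_V) _.
  have := nsizes_exp_le; rewrite expnD expn1.
  move: (2 ^ (2 ^ (m + 1) + 2 * m - 2)) (Q ^ (2 * m)) (_ ^ m) (2 ^ m * m + 2) Q => e r v l q.
  move: F => f H; have := leq_mul (leqnn (l * v * B)) H.
  by nia.
rewrite /work /cwork -/B; move: le_LV.
set l := (2 ^ m * m + 2); set v := (_ + 1) ^ m; set e := 2 ^ (_ - _).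
move: (_ * nstates m Q) => w le_w; have n_le := n_le_F.
have pos : 0 < l * v * e * (B * F).
  have [l0 v0 e0] : [/\ 0 < l, 0 < v & 0 < e].
    by rewrite /l /v /e !expn_gt0 addn2 addn1.
  by rewrite !muln_gt0 l0 v0 e0 B0.
have := leq_mul le_s (_ : w.+1 <= 2 * (l * v * e * (B * F))).
move: F F0 le_w n_le pos => f f0 le_w n_le pos.
have lt_w : w < 2 * (l * v * e * (B * f)) by lia.
move=> /(_ lt_w) H; have := leq_mul f0 (_ : 1 <= B ^ 2); rewrite expn_gt0 B0 => /(_ isT) fB.
have nB : n.+1 <= 2 * f * B ^ 2.
  apply: leq_trans (_ : 2 * f <= _); first by lia.
  by rewrite leq_pmulr // expn_gt0 B0.
rewrite -/l -/v -/e; clearbody l v e.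
rewrite 2!mulnDl; apply: leq_add => //; apply: leq_trans H _.
by rewrite expnS expn1; lia.
Qed.

End Bounds.

Theorem theorem7 (m : nat) :
  exists (P : cmd) (C k : nat),
    forall (n : nat) (I : instance m n), 0 < n ->
      exists (t : nat) (s : state),
        [/\ exec P (input I) t s,
            output_correct I s
          & t <= soft_bound C k (pmax I ^ (2 ^ (m + 1) + 2 * m - 2) + n)].
Proof.
case: (posnP m) => [-> | m_gt0].
  (* Without machines a job cannot be scheduled; the single store costs one bit each for address and
     value. *)
  exists (Store (Const 0) (Const 0)), 2, 0 => n I n_gt0.
  eexists; eexists; split; first exact: ExecStore.
    by right; split=> // sigma; case: (sigma (Ordinal n_gt0)).
  by rewrite /soft_bound expn0 muln1 /= leq_pmulr // addn_gt0 n_gt0 orbT.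
(* Of the three logarithmic factors, one counts the search rounds, one the levels, and one is the
   length of the numbers handled. *)
exists (prog m), (kprog m * cwork m * kexpr (e_max m)), 3 => n I n_gt0.
have b_gt0 : 0 < kexpr (e_max m) * bits (pmax I ^ (2 ^ (m + 1) + 2 * m - 2) + n).
  by rewrite muln_gt0 kexpr_gt0.
have [s [[t E le_t] Hout]] := run_prog m_gt0 n_gt0 b_gt0 (max_value_lt I m_gt0 n_gt0).
exists t, s; split=> //; apply: leq_trans le_t _.
have := work_le I m_gt0 n_gt0; rewrite /soft_bound; set F := _ + n => le_w.
clear E Hout b_gt0; clearbody F.
move: (work I) (kprog m) (cwork m) (kexpr _) (bits F) le_w => w x y z B le_w.
have := leq_mul le_w (leqnn (x * z * B)).
by rewrite !expnS expn0; lia.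
Qed.
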